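(* Let $K\in\mathbb{R}$, $N\in(1,\infty)$, and let $(X,d,\mathfrak{m})$ be an $MCP(K,N)$-space with the following properties: (1) For every $\mu_0,\mu_1\in\mathcal{P}_2^{ac}(X)$, there exists $\pi\in\mathrm{OptGeo}(\mu_0,\mu_1)$ that is induced by a map from $\mu_0$. (2) There exist a point $x\in X$ and $r>0$ such that the ball $B(x,r)$ is isometric to an open interval in $\mathbb{R}$. Then $X$ is a one-dimensional manifold, possibly with boundary.
   Context: Standing conventions. A metric measure space $(X,d,\mathfrak{m})$ is a complete, locally compact and separable length space $(X,d)$ (hence geodesic) equipped with a locally finite Borel measure $\mathfrak{m}$ with $\operatorname{spt}\mathfrak{m}=X$. $B(x,r)$ denotes the open ball. $\mathrm{Geo}(X)$ is the space of constant speed, length minimising geodesics $\gamma:[0,1]\to X$, with the supremum distance; $e_t:\mathrm{Geo}(X)\to X$, $e_t(\gamma)=\gamma_t$. $\mathcal{P}(X)$ is the set of Borel probability measures on $X$; $\mathcal{P}_2(X)$ is the set of those with finite second moment; $\mathcal{P}_2^{ac}(X)$ is the set of $\mu\in\mathcal{P}_2(X)$ absolutely continuous with respect to $\mathfrak{m}$. For $\mu_0,\mu_1\in\mathcal{P}_2(X)$, $\mathrm{Opt}(\mu_0,\mu_1)$ is the set of minimisers of $\int d^2(x,y)\,d\sigma(x,y)$ among all $\sigma\in\mathcal{P}(X\times X)$ with first marginal $\mu_0$ and second marginal $\mu_1$, and $\mathrm{OptGeo}(\mu_0,\mu_1)$ is the set of $\pi\in\mathcal{P}(\mathrm{Geo}(X))$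 with $(e_0,e_1)_\#\pi\in\mathrm{Opt}(\mu_0,\mu_1)$. A plan $\pi\in\mathrm{OptGeo}(\mu_0,\mu_1)$ is induced by a map (from $\mu_0$) if there is a Borel map $T:X\to\mathrm{Geo}(X)$ with $\pi=T_\#\mu_0$ and $e_0\circ T=\mathrm{id}$. Distortion coefficients. For $t\in[0,1]$, $\theta\ge0$, put $\tau_{K,N}^{(t)}(\theta)=t^{1/N}\big(\sigma_{K,N-1}^{(t)}(\theta)\big)^{(N-1)/N}$, where $\sigma_{K,N-1}^{(t)}(\theta)$ equals $+\infty$ if $K\theta^2\ge(N-1)\pi^2$; $\frac{\sin(t\theta\sqrt{K/(N-1)})}{\sin(\theta\sqrt{K/(N-1)})}$ if $0<K\theta^2<(N-1)\pi^2$; $t$ if $K\theta^2=0$; $\frac{\sinh(t\theta\sqrt{-K/(N-1)})}{\sinh(\theta\sqrt{-K/(N-1)})}$ if $K\theta^2<0$. $(X,d,\mathfrak{m})$ is an $MCP(K,N)$-space if for every $o\in X$ and every Borel set $A\subset X$ with $0<\mathfrak{m}(A)<\infty$ and $\mu_0:=\mathfrak{m}|_A/\mathfrak{m}(A)\in\mathcal{P}_2(X)$ (and $A\subset B(o,\pi\sqrt{(N-1)/K})$ if $K>0$) there is $\pi\in\mathrm{OptGeo}(\mu_0,\delta_o)$ such that for all $t\in[0,1]$, $\frac{1}{\mathfrak{m}(A)}\mathfrak{m}\ge(e_t)_\#\big(\tau_{K,N}^{(1-t)}(d(\gamma_0,\gamma_1))^N\,\pi(d\gamma)\big)$. *)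

(* Defs.v *)
From HB Require Import structures.
From mathcomp Require Import all_boot all_order all_algebra.
From mathcomp Require Import all_classical all_reals all_analysis.

Set Implicit Arguments.
Unset Strict Implicit.
Unset Printing Implicit Defensive.

Import Order.TTheory GRing.Theory Num.Theory.
Import numFieldNormedType.Exports.

Local Open Scope classical_set_scope.
Local Open Scope ring_scope.

(* The library's [completeType] is pointed, hence so is this structure. *)
#[short(type="completeMetricType")]
HB.structure Definition CompleteMetric (R : numDomainType) :=
  { M of Complete M & PseudoPointedMetric R M & PseudoMetric_isMetric R M }.

Notation borel T := (g_sigma_algebraType (@open T)).

Section length_space.
Context {R : realType} (X : metricType R).

Definition curve_variation (c : R -> X) (s : seq R) : R :=
  let F := c \o nth 1 (0 :: s) in \sum_(0 <= n < size s) mdist (F n) (F n.+1).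

Definition curve_length (c : R -> X) : \bar R :=
  ereal_sup [set (curve_variation c s)%:E | s in itv_partition 0 1].

Definition length_space := forall x y : X,
  (mdist x y)%:E = ereal_inf [set curve_length c | c in
    [set c : R -> X | [/\ {within `[0, 1], continuous c}, c 0 = x & c 1 = y]]].

End length_space.

Definition separable (T : topologicalType) :=
  exists2 D : set T, countable D & dense D.

Section metric_measure_space.
Context {R : realType} {X : completeMetricType R}.
Variable m : {measure set (borel X) -> \bar R}.

Definition locally_finite :=
  forall x : X, exists2 U, open_nbhs x U & (m U < +oo)%E.

Definition measure_support : set X :=
  [set x | forall U, open_nbhs x U -> (0 < m U)%E].

Definition metric_measure_space :=
  [/\ locally_compact [set: X], separable X, length_space X,
      locally_finite & measure_support = [set: X]].

End metric_measure_space.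

Section geodesics.
Context {R : realType}.

(* A map [0, 1] -> X is a constant speed, length minimising geodesic when
   d(g_s, g_t) = |s - t| d(g_0, g_1) for all s and t. *)
Record geo (X : metricType R) := Geo {
  geo_fun :> {i01 R} -> X ;
  geo_const_speed : forall s t : {i01 R}, mdist (geo_fun s) (geo_fun t) =
    `|s%:num - t%:num| * mdist (geo_fun 0%:i01) (geo_fun 1%:i01) }.

HB.instance Definition _ (X : metricType R) := gen_eqMixin (geo X).
HB.instance Definition _ (X : metricType R) := gen_choiceMixin (geo X).

Section sup_distance.
Context (X : metricType R).
Implicit Types g h k : geo X.

Lemma geoP g h : g =1 h -> g = h.
Proof.
case: g h => [g gP] [h hP] /= /funext gh.
by subst h; congr Geo; exact: Prop_irrelevance.
Qed.

Definition geo_dist g h : R := sup [set mdist (g t) (h t) | t in [set: {i01 R}]].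

Lemma geo_dist_has_sup g h :
  has_sup [set mdist (g t) (h t) | t in [set: {i01 R}]].
Proof.
split; first by exists (mdist (g 0%:i01) (h 0%:i01)), 0%:i01.
exists (mdist (g 0%:i01) (g 1%:i01) + mdist (g 0%:i01) (h 0%:i01)
        + mdist (h 0%:i01) (h 1%:i01)) => _ [t _ <-].
have t01 (k : geo X) (u : {i01 R}) :
    mdist (k 0%:i01) (k u) <= mdist (k 0%:i01) (k 1%:i01).
  by rewrite geo_const_speed /= sub0r normrN ger0_norm// ler_piMl// mdist_ge0.
apply: (le_trans (metric_triangle _ (h 0%:i01) _)); apply: lerD => //.
apply: (le_trans (metric_triangle _ (g 0%:i01) _)); apply: lerD => //.
by rewrite metric_sym t01.
Qed.

Lemma mdist_geo_dist g h t : mdist (g t) (h t) <= geo_dist g h.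
Proof. by apply: sup_upper_bound; [exact: geo_dist_has_sup|exists t]. Qed.

Lemma geo_dist_le g h e : (forall t, mdist (g t) (h t) <= e) -> geo_dist g h <= e.
Proof.
move=> ghe; apply: ge_sup; first by case: (geo_dist_has_sup g h).
by move=> _ [t _ <-].
Qed.

Let geo_distxx g : geo_dist g g = 0.
Proof.
apply/eqP; rewrite eq_le geo_dist_le/= => [|t]; last by rewrite mdistxx.
by rewrite (le_trans _ (mdist_geo_dist _ _ 0%:i01))// mdistxx.
Qed.

Let geo_dist_positivity g h : geo_dist g h = 0 -> g = h.
Proof.
move=> gh0; apply: geoP => t; apply: (@mdist_positivity R).
by apply/eqP; rewrite eq_le mdist_ge0 andbT -gh0 mdist_geo_dist.
Qed.

Let geo_dist_sym g h : geo_dist g h = geo_dist h g.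
Proof.
by rewrite /geo_dist; congr (sup (_ @` _)); apply/funext => t; rewrite metric_sym.
Qed.

Let geo_dist_triangle h g k : geo_dist g k <= geo_dist g h + geo_dist h k.
Proof.
apply: geo_dist_le => t; apply: (le_trans (metric_triangle _ (h t) _)).
by rewrite lerD// mdist_geo_dist.
Qed.

HB.instance Definition _ := @isMetric.Build R (geo X) geo_dist
  geo_distxx geo_dist_positivity geo_dist_sym geo_dist_triangle.

End sup_distance.

Section pointed.
Context (X : completeMetricType R).

Lemma constant_geo_subproof (x : X) (s t : {i01 R}) :
  mdist x x = `|s%:num - t%:num| * mdist x x.
Proof. by rewrite mdistxx mulr0. Qed.

Definition constant_geo (x : X) : geo X :=
  @Geo X (fun=> x) (constant_geo_subproof x).

HB.instance Definition _ := isPointed.Build (geo X) (constant_geo point).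

End pointed.

Definition geo_eval (X : metricType R) (t : {i01 R}) (g : geo X) : X := g t.

Definition geo_ends (X : metricType R) (g : geo X) : X * X :=
  (g 0%:i01, g 1%:i01).

Definition geo_length (X : metricType R) (g : geo X) : R :=
  mdist (g 0%:i01) (g 1%:i01).

End geodesics.

Section optimal_transport.
Context {R : realType} {X : completeMetricType R}.
Implicit Types (mu : probability (borel X) R)
  (sigma : probability (borel (X * X)%type) R)
  (p : probability (borel (geo X)) R).

(* Equality of set functions is only meaningful on measurable sets: the library
   leaves the values of a measure elsewhere unconstrained. *)
Definition eq_on_measurable d (T : measurableType d) (mu nu : set T -> \bar R) :=
  forall A, measurable A -> mu A = nu A.

Definition P2 : set (probability (borel X) R) :=
  [set mu : probability (borel X) R | exists x0 : X,
    (\int[mu]_x ((mdist x0 (x : X)) ^+ 2)%:E < +oo)%E].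

Definition P2ac (m : {measure set (borel X) -> \bar R}) :
    set (probability (borel X) R) :=
  [set mu : probability (borel X) R | P2 mu /\ mu `<< m].

Definition coupling mu0 mu1 : set (probability (borel (X * X)%type) R) :=
  [set sigma : probability (borel (X * X)%type) R |
    eq_on_measurable (pushforward sigma (fst : borel (X * X)%type -> borel X)) mu0 /\
    eq_on_measurable (pushforward sigma (snd : borel (X * X)%type -> borel X)) mu1].

Definition transport_cost sigma : \bar R :=
  (\int[sigma]_z ((mdist (z : X * X).1 (z : X * X).2) ^+ 2)%:E)%E.

Definition Opt mu0 mu1 : set (probability (borel (X * X)%type) R) :=
  [set sigma : probability (borel (X * X)%type) R | coupling mu0 mu1 sigma /\
    forall sigma', coupling mu0 mu1 sigma' ->
      (transport_cost sigma <= transport_cost sigma')%E].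

Definition OptGeo mu0 mu1 : set (probability (borel (geo X)) R) :=
  [set p : probability (borel (geo X)) R | exists2 sigma, Opt mu0 mu1 sigma &
    eq_on_measurable
      (pushforward p (@geo_ends R X : borel (geo X) -> borel (X * X)%type))
      sigma].

Definition induced_by_map mu0 p :=
  exists T : borel X -> borel (geo X),
    [/\ measurable_fun [set: borel X] T, eq_on_measurable (pushforward mu0 T) p &
        forall x, geo_eval 0%:i01 (T x) = x].

End optimal_transport.

Section distortion.
Context {R : realType}.
Implicit Types K N t theta : R.

Definition sinh (x : R) : R := (expR x - expR (- x)) / 2.

Definition sigma_coef K N t theta : \bar R :=
  if N * pi ^+ 2 <= K * theta ^+ 2 then +oo%E
  else if 0 < K * theta ^+ 2 then
    (sin (t * theta * Num.sqrt (K / N)) / sin (theta * Num.sqrt (K / N)))%:E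
  else if K * theta ^+ 2 == 0 then t%:E
  else
    (sinh (t * theta * Num.sqrt (- K / N))
      / sinh (theta * Num.sqrt (- K / N)))%:E.

(* In case t = 0 and sigma = +oo, the library's convention 0 * +oo = 0 applies. *)
Definition tau_coef K N t theta : \bar R :=
  ((t `^ N^-1)%:E * poweR (sigma_coef K (N - 1) t theta) ((N - 1) / N))%E.

End distortion.

Section MCP.
Context {R : realType} {X : completeMetricType R}.
Variables (K N : R) (m : {measure set (borel X) -> \bar R}).

Definition MCP := forall (o : X) (A : set (borel X)) (mA : measurable A),
  (0 < m A < +oo)%E ->
  forall mu0 : probability (borel X) R,
  eq_on_measurable mu0 (fun B => ((fine (m A))^-1)%R%:E * mrestr m mA B)%E ->
  P2 mu0 ->
  (0 < K -> A `<=` (ball o (pi * Num.sqrt ((N - 1) / K)) : set X)) ->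
  exists2 p : probability (borel (geo X)) R,
    OptGeo mu0 (dirac (o : borel X)) p &
    forall t : {i01 R}, forall B : set (borel X), measurable B ->
      (pushforward
         (fun S : set (borel (geo X)) => \int[p]_(g in S)
            poweR (tau_coef K N (1 - t%:num)%R (geo_length (g : geo X))) N)
         (geo_eval t : borel (geo X) -> borel X) B
       <= ((fine (m A))^-1)%R%:E * m B)%E.

End MCP.

Definition isometric_to_open_interval (R : realType) (X : metricType R) (U : set X) :=
  exists (I : set R) (f : X -> R), [/\ open I, is_interval I, f @` U = I &
    {in U &, forall x y, `|f x - f y| = mdist x y}].

Definition homeomorphic_subsets (S T : topologicalType) (U : set S) (V : set T) :=
  exists (f : S -> T) (g : T -> S),
    [/\ {within U, continuous f}, {within V, continuous g},
        set_fun U V f, set_fun V U g &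
        {in U, cancel f g} /\ {in V, cancel g f}].

(* Charts take values in relatively open subsets of the half-line [0, +oo). *)
Definition one_manifold_with_boundary (R : realType) (X : topologicalType) :=
  [/\ hausdorff_space X, @second_countable X &
      forall x : X, exists (U : set X) (W : set R),
        [/\ open_nbhs x U, open W &
            homeomorphic_subsets U (W `&` [set t | 0 <= t])]].

(* Main.v *)
From HB Require Import structures.
Require Import Defs.
From mathcomp Require Import all_boot all_order all_algebra.
From mathcomp Require Import all_classical all_reals all_analysis.
From mathcomp Require Import measurable_realfun.
From mathcomp Require Import ring lra.

(* Call a point regular if a ball around it is isometric to (-r, r); a point on
   its positive (negative) side is one reached by distance-realizing routes
   through the positive (negative) half of that interval.  Everything rests on
   one rigidity statement: on either side of a regular point x, the distance to x
   is injective at small scales.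

   Suppose y <> z lie on the positive side of x at the same distance l.  Let A be a
   small ball in the interval, and contract m|A towards y and towards z by MCP up
   to a time t < 1 so late that the two images lie near y and near z and are thus
   disjoint.  By MCP both images are absolutely continuous, and each is carried to
   the same affine image of the position in A by the distance to x.  Transporting
   m|A to the average of the two is therefore a one-dimensional quadratic problem
   whose optimal plan is an affine monotone map of the distance to x, unique by
   completing a square; an optimal map would have to send each a in A to only one
   of the two images, and since a can be recovered from its target, the set E of
   those sent near y satisfies mu0(E) = mu0(E) / 2 and mu0(E) = 1 / 2.

   Injectivity yields unique geodesics, then regularity of all interior points of
   geodesics issued from a regular point, and finally the local structure: near
   any point X is isometric to an open interval or to a half-open one. *)

Set Implicit Arguments.
Unset Strict Implicit.
Unset Printing Implicit Defensive.

Import Order.TTheory GRing.Theory Num.Theory.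
Import numFieldNormedType.Exports.

Local Open Scope classical_set_scope.
Local Open Scope ring_scope.

(** * Borel sets and measures *)

Section borel.
Context {R : realType}.

Lemma generated_measurable_fun (S T : pointedType) (G : set (set S))
    (H : set (set T)) (f : S -> T) :
  (forall B, H B -> G (f @^-1` B)) ->
  measurable_fun [set: g_sigma_algebraType G]
    (f : g_sigma_algebraType G -> g_sigma_algebraType H).
Proof.
move=> HG; apply: (@measurability _ _ (g_sigma_algebraType G)
  (g_sigma_algebraType H) _ _ H erefl).
by move=> _ [B HB <-]; rewrite setTI; apply: sub_sigma_algebra; exact: HG.
Qed.

Lemma generated_measurable_real (S : pointedType) (G : set (set S))
    (f : S -> R) :
  (forall B, open B -> G (f @^-1` B)) ->
  measurable_fun [set: g_sigma_algebraType G] (f : g_sigma_algebraType G -> R).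
Proof.
move=> oG; apply: (measurability _ (RGenOpens.measurableE R)).
move=> _ [_ [a [b ->] <-]]; rewrite setTI.
by apply: sub_sigma_algebra; exact/oG/interval_open.
Qed.

Lemma generated_measurable_preimage (S T : pointedType) (G : set (set S))
    (H : set (set T)) (f : S -> T) :
  (forall B, H B -> G (f @^-1` B)) ->
  forall B : set (g_sigma_algebraType H), measurable B ->
  measurable ((f @^-1` B) : set (g_sigma_algebraType G)).
Proof.
move=> HG B mB; rewrite -[X in measurable X]setTI.
exact: generated_measurable_fun.
Qed.

Lemma open_borel (T : ptopologicalType) (A : set T) :
  open A -> measurable (A : set (borel T)).
Proof. exact: sub_sigma_algebra. Qed.

Lemma closed_borel (T : ptopologicalType) (A : set T) :
  closed A -> measurable (A : set (borel T)).
Proof.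
move=> /closed_openC /open_borel mA; rewrite -(setCK A).
exact: (@measurableC _ (borel T)).
Qed.

End borel.

Section probability.
Context {R : realType}.
Local Open Scope ereal_scope.

Lemma pushforward_probability d d' (T : measurableType d)
    (T' : measurableType d') (P : probability T R) (f : T -> T') :
  measurable_fun [set: T] f ->
  exists Q : probability T' R, forall A, Q A = P (f @^-1` A).
Proof.
move=> mf; pose F : {mfun T >-> T'} := HB.pack f (isMeasurableFun.Build _ _ _ _ _ mf).
by exists (distribution P F).
Qed.

Lemma half_mixture d (T : measurableType d) (P1 P2 : probability T R) :
  exists Q : probability T R,
    forall A, Q A = (2^-1)%R%:E * P1 A + (2^-1)%R%:E * P2 A.
Proof.
have h0 : (0 <= 2^-1 :> R)%R by rewrite invr_ge0.
pose Q := measure_add (mscale (NngNum h0) P1) (mscale (NngNum h0) P2).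
have QE A : Q A = (2^-1)%R%:E * P1 A + (2^-1)%R%:E * P2 A by rewrite /Q measure_addE.
have Q1 : Q setT = 1.
  rewrite QE !probability_setT !mule1 -EFinD.
  by congr EFin; lra.
pose Q' : probability T R :=
  HB.pack (Q : set T -> \bar R) (Measure.on Q)
    (Measure_isProbability.Build _ _ _ Q Q1).
by exists Q'.
Qed.

Lemma normalized_restriction d (T : measurableType d)
    (m : {measure set T -> \bar R}) (A : set T) (mA : measurable A) :
  0 < m A < +oo ->
  exists Q : probability T R,
    forall B, Q B = ((fine (m A))^-1)%R%:E * mrestr m mA B.
Proof.
move=> /andP[A0 Aoo].
have mAfin : m A \is a fin_num by rewrite ge0_fin_numE.
have r0 : (0 <= (fine (m A))^-1)%R by rewrite invr_ge0 fine_ge0.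
pose Q := mscale (NngNum r0) (mrestr m mA).
have Q1 : Q setT = 1.
  have -> : Q setT = (fine (m A))^-1%:E * m (setT `&` A) by [].
  rewrite setTI -[X in _ * X]fineK// -EFinM mulVf//.
  by rewrite gt_eqF// fine_gt0// A0 Aoo.
pose Q' : probability T R :=
  HB.pack (Q : set T -> \bar R) (Measure.on Q)
    (Measure_isProbability.Build _ _ _ Q Q1).
by exists Q'.
Qed.

End probability.

Lemma measurable_neqr d (T : measurableType d) (R : realType) (f g : T -> R) :
  measurable_fun [set: T] f -> measurable_fun [set: T] g ->
  measurable [set x | f x != g x].
Proof.
move=> mf mg.
have -> : [set x | f x != g x] = setT `&` [set x | (EFin \o f) x != (EFin \o g) x].
  by rewrite setTI; apply/seteqP; split => x /=; rewrite eqe.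
by apply: measurable_neqe => //; exact/measurable_EFinP.
Qed.

(** * Distortion coefficients *)

Section distortion.
Context {R : realType}.
Implicit Types K N t theta D : R.

Lemma sin_mvt (x : R) : 0 <= x -> exists2 c, 0 <= c <= x & sin x = cos c * x.
Proof.
move=> x0; have dsin y : y \in `]0, x[%R -> is_derive y 1 sin (cos y).
  by move=> _; exact: is_derive_sin.
have csin : {within `[0, x], continuous (@sin R)}.
  by apply: continuous_subspaceT => y; exact: continuous_sin.
have [c /[!in_itv]/= c0x] := MVT_segment x0 dsin csin.
by rewrite sin0 !subr0 => ->; exists c.
Qed.

(** The mean value theorem gives [sin (t * x) = cos c * (t * x)] with [c <= 1], where the cosine is
    at least [cos 1], and also [sin x <= x]. *)
Lemma sin_ratio_ge t (x : R) : 0 < t <= 1 -> 0 < x <= 1 ->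
  cos 1 * t <= sin (t * x) / sin x.
Proof.
move=> /andP[t0 t1] /andP[x0 x1].
have sx0 : 0 < sin x by apply: sin2_gt0; rewrite x0/= (le_lt_trans x1)// ltr1n.
have [d /andP[d0 dx] sxE] := sin_mvt (ltW x0).
have [c /andP[c0 cx] ->] := sin_mvt (mulr_ge0 (ltW t0) (ltW x0)).
have pi1 : 1 <= pi :> R by rewrite (le_trans _ (pi_ge2 R))// ler1n.
have c1 : c <= 1 by rewrite (le_trans cx)// mulr_ile1// ltW.
have cosc : cos 1 <= cos c.
  move: c1; rewrite le_eqVlt => /predU1P[->//|c1].
  by rewrite ltW// ltr_cos// in_itv/= ?ler01 ?c0//= (le_trans (ltW c1)).
rewrite ler_pdivlMr//.
apply: (@le_trans _ _ (cos 1 * t * x)).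
  rewrite ler_pM2l ?mulr_gt0 ?cos1_gt0//.
  by rewrite sxE -[leRHS]mul1r ler_wpM2r ?cos_le1// ltW.
by rewrite -mulrA ler_wpM2r// mulr_ge0// ltW.
Qed.

(** Both estimates come from [1 + y <= expR y]: it yields [sinh x <= x * expR x] for the denominator
    and [t * x / 2 <= sinh (t * x)] for the numerator. *)
Lemma sinh_ratio_ge t (x : R) : 0 < t <= 1 -> 0 < x ->
  t * expR (- x) / 2 <= sinh (t * x) / sinh x.
Proof.
move=> /andP[t0 t1] x0.
have sx0 : 0 < sinh x by rewrite /sinh divr_gt0// subr_gt0 ltr_expR; lra.
rewrite ler_pdivlMr//.
have sx : sinh x <= x * expR x.
  have e1 := expR_ge1Dx (- (x *+ 2)).
  have ex := expR_gt0 x.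
  have -> : sinh x = expR x * (1 - expR (- (x *+ 2))) / 2.
    rewrite /sinh mulrBr mulr1 -expRD; congr ((_ - expR _) / _).
    by rewrite mulr2n; ring.
  by nra.
have st : t * x / 2 <= sinh (t * x).
  have e1 := expR_ge1Dx (t * x).
  have : expR (- (t * x)) <= 1 by rewrite expR_le1 oppr_le0 mulr_ge0// ltW.
  by rewrite /sinh; lra.
apply: le_trans st.
apply: (@le_trans _ _ (t * expR (- x) / 2 * (x * expR x))).
  by rewrite ler_wpM2l// divr_ge0// mulr_ge0 ?expR_ge0// ltW.
have := expRxMexpNx_1 x; rewrite le_eqVlt => e; apply/orP; left; apply/eqP.
by rewrite -[RHS]mulr1 -e; ring.
Qed.

(** The minimum of the bounds for the linear, sine and hyperbolic sine branches serves all of them.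
    The hypothesis on [D] keeps the argument of the sine in (0, 1], and [L] bounds the argument of
    the hyperbolic sine. *)
Lemma sigma_coef_ge K (M t D : R) : 0 < M -> 0 < t <= 1 ->
  (0 < K -> D * Num.sqrt (K / M) <= 1) ->
  exists2 c : R, 0 < c & forall theta, 0 <= theta <= D ->
    (c%:E <= sigma_coef K M t theta)%E.
Proof.
move=> M0 t01 KD; have /andP[t0 t1] := t01.
pose L := D * Num.sqrt (- K / M).
exists (Num.min t (Num.min (cos 1 * t) (t * expR (- L) / 2))).
  by rewrite !lt_min t0 mulr_gt0 ?cos1_gt0//= divr_gt0// mulr_gt0 ?expR_gt0.
move=> theta /andP[th0 thD]; rewrite /sigma_coef.
case: ifPn => _; first exact: leey.
case: ifPn => [Kth|].
  have K0 : 0 < K.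
    by rewrite ltNge; apply/negP => K0; move: Kth; rewrite ltNge mulr_le0_ge0// sqr_ge0.
  have th0' : 0 < theta.
    by rewrite lt_neqAle th0 andbT; apply: contraTN Kth => /eqP <-; rewrite expr0n mulr0 ltxx.
  rewrite lee_fin 2!ge_min; apply/orP; right; apply/orP; left.
  rewrite -(mulrA t theta); apply: sin_ratio_ge => //.
  rewrite mulr_gt0 ?sqrtr_gt0 ?divr_gt0//=.
  by rewrite (le_trans _ (KD K0))// ler_wpM2r.
rewrite -leNgt => Kth; case: ifPn => [_|Kth0].
  by rewrite lee_fin ge_min lexx.
have {}Kth : K * theta ^+ 2 < 0 by rewrite lt_neqAle Kth0.
have K0 : K < 0.
  by rewrite ltNge; apply/negP => K0; move: Kth; rewrite ltNge mulr_ge0// sqr_ge0.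
have th0' : 0 < theta.
  by rewrite lt_neqAle th0 andbT; apply: contraNN Kth0 => /eqP <-; rewrite expr0n mulr0.
rewrite lee_fin 2!ge_min; apply/orP; right; apply/orP; right.
have x0 : 0 < theta * Num.sqrt (- K / M).
  by rewrite mulr_gt0// sqrtr_gt0 divr_gt0// oppr_gt0.
rewrite -(mulrA t theta); apply: le_trans (sinh_ratio_ge t01 x0).
by rewrite ler_pM2r// ler_pM2l// ler_expR lerN2 ler_wpM2r.
Qed.

(** Uniformity in [theta] is the point: on geodesics of length at most [D], the MCP inequality
    becomes domination of the time marginal by a multiple of [m]. *)
Lemma tau_coef_ge K N t D : 1 < N -> 0 < t <= 1 ->
  (0 < K -> D * Num.sqrt (K / (N - 1)) <= 1) ->
  exists2 c : R, 0 < c & forall theta, 0 <= theta <= D ->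
    (c%:E <= poweR (tau_coef K N t theta) N)%E.
Proof.
move=> N1 t01 KD; have N0 : 0 < N by exact: lt_trans N1.
have M0 : 0 < N - 1 by rewrite subr_gt0.
have [c c0 cle] := sigma_coef_ge M0 t01 KD; have /andP[t0 t1] := t01.
have h : 0 < t `^ N^-1 * c `^ ((N - 1) / N) by rewrite mulr_gt0 ?powR_gt0.
exists ((t `^ N^-1 * c `^ ((N - 1) / N)) `^ N); first by rewrite powR_gt0.
move=> theta thD; rewrite -poweR_EFin.
have tle : ((t `^ N^-1 * c `^ ((N - 1) / N))%:E <= tau_coef K N t theta)%E.
  rewrite /tau_coef EFinM lee_wpmul2l//; first by rewrite lee_fin ltW// powR_gt0.
  rewrite -poweR_EFin gt0_ler_poweR ?cle//.
  - by rewrite divr_ge0// ltW.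
  - by rewrite in_itv/= lee_fin ltW// leey.
  - by rewrite in_itv/= leey andbT (le_trans _ (cle _ thD))// lee_fin ltW.
rewrite gt0_ler_poweR//.
- exact: ltW.
- by rewrite in_itv/= lee_fin leey ltW.
- by rewrite in_itv/= leey andbT (le_trans _ tle)// lee_fin ltW.
Qed.

End distortion.

(** * Rigidity of affine transport *)

Section affine_transport.
Context {R : realType}.
Local Open Scope ereal_scope.

Lemma ge0_integral_law_eq d (T : measurableType d) (P P' : probability T R)
    d' (T' : measurableType d') (u : T -> T') (g : T' -> \bar R) :
  measurable_fun [set: T] u ->
  (forall A, measurable A -> P (u @^-1` A) = P' (u @^-1` A)) ->
  measurable_fun [set: T'] g -> (forall x, 0 <= g x) ->
  \int[P]_z g (u z) = \int[P']_z g (u z).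
Proof.
move=> mu PP' mg g0.
have E (Q : probability T R) : \int[Q]_z g (u z) = \int[pushforward Q u]_y g y.
  by rewrite ge0_integral_pushforward// => y _; exact: g0.
by rewrite !E; apply: eq_measure_integral => A mA _; exact: PP'.
Qed.

Variables (d : measure_display) (Z : measurableType d).
Variables (P P' : probability Z R) (u v : Z -> R) (k b : R).
Hypotheses (mu : measurable_fun [set: Z] u) (mv : measurable_fun [set: Z] v).
Hypotheses (u0 : forall z, (0 <= u z)%R) (v0 : forall z, (0 <= v z)%R).
Hypotheses (k0 : (0 <= k)%R) (k1 : (k <= 1)%R) (b0 : (0 <= b)%R).
Hypothesis Pu : forall A, measurable A -> P (u @^-1` A) = P' (u @^-1` A).
Hypothesis Pv : forall A, measurable A -> P (v @^-1` A) = P' (v @^-1` A).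

Let q z : R := ((v z - (k * u z + b)) ^+ 2)%R.
Let wl z : R := (2 * b * v z + k * (1 - k) * u z ^+ 2)%R.
Let wr z : R := ((1 - k) * v z ^+ 2 + (2 * k * b * u z + b ^+ 2))%R.

Let mq : measurable_fun [set: Z] q.
Proof.
apply: measurable_funX; apply: measurable_funB => //.
by apply: measurable_funD => //; exact: measurable_funM.
Qed.

(* Expanding the square of the defect: after moving the negative terms across,
   both sides are integrals of nonnegative functions. *)
Let defect_cost (Q : probability Z R) :
  \int[Q]_z (q z)%:E + \int[Q]_z (wl z)%:E =
  k%:E * \int[Q]_z ((v z - u z) ^+ 2)%:E + \int[Q]_z (wr z)%:E.
Proof.
have wl0 z : (0 <= wl z)%R.
  by rewrite addr_ge0// !mulr_ge0// ?subr_ge0// sqr_ge0.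
have wr0 z : (0 <= wr z)%R.
  by rewrite !addr_ge0// ?mulr_ge0// ?subr_ge0// sqr_ge0.
have mc : measurable_fun [set: Z] (fun z => ((v z - u z) ^+ 2)%:E).
  by apply/measurable_EFinP; apply: measurable_funX; exact: measurable_funB.
have mwl : measurable_fun [set: Z] (EFin \o wl).
  apply/measurable_EFinP; apply: measurable_funD; apply: measurable_funM => //.
  exact: measurable_funX.
have mwr : measurable_fun [set: Z] (EFin \o wr).
  apply/measurable_EFinP; apply: measurable_funD.
    by apply: measurable_funM => //; exact: measurable_funX.
  by apply: measurable_funD => //; exact: measurable_funM.
have c0 z : 0 <= ((v z - u z) ^+ 2)%:E by rewrite lee_fin sqr_ge0.
have mkc : measurable_fun [set: Z] (fun z => k%:E * ((v z - u z) ^+ 2)%:E).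
  exact: measurable_funeM.
rewrite -ge0_integralZl_EFin// -ge0_integralD//; last 3 first.
- by move=> z _; rewrite lee_fin sqr_ge0.
- exact/measurable_EFinP.
- by move=> z _; rewrite lee_fin.
rewrite -ge0_integralD//; last 2 first.
- by move=> z _; rewrite mule_ge0.
- by move=> z _; rewrite lee_fin.
apply: eq_integral => z _; rewrite -!EFinM -!EFinD /q /wl /wr.
by congr EFin; ring.
Qed.

(** Equal laws of [u] and of [v] give [wl] and [wr] the same integrals under [P] and [P']. By
    [defect_cost], the smaller cost of [P] then forces the integral of [q] under [P] to be at most
    that under [P'], which is zero. *)
Lemma affine_transport_rigidity :
  \int[P']_z (v z)%:E < +oo -> \int[P']_z (u z ^+ 2)%:E < +oo ->
  \int[P]_z ((v z - u z) ^+ 2)%:E <= \int[P']_z ((v z - u z) ^+ 2)%:E ->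
  P' [set z | v z != (k * u z + b)%R] = 0 ->
  P [set z | v z != (k * u z + b)%R] = 0.
Proof.
move=> foo uoo cost E'.
have mE : measurable [set z | v z != (k * u z + b)%R].
  by apply: measurable_neqr => //; apply: measurable_funD => //; exact: measurable_funM.
have q0 (Q : probability Z R) :
    \int[Q]_z (q z)%:E = 0 <-> Q [set z | v z != (k * u z + b)%R] = 0.
  have mqE : measurable_fun [set: Z] (EFin \o q) by exact/measurable_EFinP.
  have [h1 h2] := ae_eq_integral_abs Q measurableT mqE.
  have -> : \int[Q]_z (q z)%:E = \int[Q]_z `|(EFin \o q) z|.
    by apply: eq_integral => z _; rewrite gee0_abs// lee_fin sqr_ge0.
  split=> [/h1 [A [mA QA0 sA]]|Q0].
    apply: (subset_measure0 mE mA _ QA0) => z /= vz; apply: sA => /=.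
    move=> /(_ Logic.I)[] /eqP; rewrite /q sqrf_eq0 subr_eq0.
    exact/negP.
  apply: h2; exists [set z | v z != (k * u z + b)%R]; split => // z /=.
  apply: contra_notN => /eqP vz _.
  by rewrite /q vz subrr expr0n.
have kk0 : (0 <= k * (1 - k))%R by rewrite mulr_ge0// subr_ge0.
have bb0 : (0 <= 2 * b)%R by rewrite mulr_ge0.
have kb0 : (0 <= 2 * k * b)%R by rewrite !mulr_ge0.
have k10 : (0 <= 1 - k)%R by rewrite subr_ge0.
(* The absolute value makes the integrand nonnegative on the whole line, as [ge0_integral_law_eq]
   demands; it is harmless because [v] is nonnegative. *)
have mgv : measurable_fun [set: R] (fun x : R => (2 * b * `|x|)%:E).
  by apply/measurable_EFinP; apply: measurable_funM => //; exact: measurable_normr.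
have mgu : measurable_fun [set: R] (fun x : R => (k * (1 - k) * x ^+ 2)%:E).
  by apply/measurable_EFinP; apply: measurable_funM => //; exact: measurable_funX.
have gv0 x : 0 <= (2 * b * `|x|)%:E by rewrite lee_fin mulr_ge0.
have gu0 x : 0 <= (k * (1 - k) * x ^+ 2)%:E.
  by rewrite lee_fin mulr_ge0// sqr_ge0.
have mfv : measurable_fun [set: R] (fun x : R => ((1 - k) * x ^+ 2)%:E).
  by apply/measurable_EFinP; apply: measurable_funM => //; exact: measurable_funX.
have mfu : measurable_fun [set: R] (fun x : R => (2 * k * b * `|x| + b ^+ 2)%:E).
  apply/measurable_EFinP; apply: measurable_funD => //.
  by apply: measurable_funM => //; exact: measurable_normr.
have fv0 x : 0 <= ((1 - k) * x ^+ 2)%:E by rewrite lee_fin mulr_ge0// sqr_ge0.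
have fu0 x : 0 <= (2 * k * b * `|x| + b ^+ 2)%:E.
  by rewrite lee_fin addr_ge0// ?sqr_ge0// mulr_ge0.
have wl_split (Q : probability Z R) : \int[Q]_z (wl z)%:E =
    \int[Q]_z (2 * b * `|v z|)%:E + \int[Q]_z (k * (1 - k) * u z ^+ 2)%:E.
  rewrite -ge0_integralD//.
  - by apply: eq_integral => z _; rewrite -EFinD /wl ger0_norm.
  - by apply: (measurableT_comp mgv).
  - by apply: (measurableT_comp mgu).
have wr_split (Q : probability Z R) : \int[Q]_z (wr z)%:E =
    \int[Q]_z ((1 - k) * v z ^+ 2)%:E +
    \int[Q]_z (2 * k * b * `|u z| + b ^+ 2)%:E.
  rewrite -ge0_integralD//.
  - by apply: eq_integral => z _; rewrite -EFinD /wr ger0_norm.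
  - by apply: (measurableT_comp mfv).
  - by apply: (measurableT_comp mfu).
have wlE : \int[P]_z (wl z)%:E = \int[P']_z (wl z)%:E.
  by rewrite !wl_split (ge0_integral_law_eq mv Pv mgv)// (ge0_integral_law_eq mu Pu mgu).
have wrE : \int[P]_z (wr z)%:E = \int[P']_z (wr z)%:E.
  by rewrite !wr_split (ge0_integral_law_eq mv Pv mfv)// (ge0_integral_law_eq mu Pu mfu).
(* Finiteness allows this term to be cancelled from the final inequality; a first moment of [v] and
   a second moment of [u] suffice for it. *)
have wloo : \int[P']_z (wl z)%:E \is a fin_num.
  rewrite ge0_fin_numE; last first.
    by rewrite wl_split adde_ge0// integral_ge0.
  rewrite wl_split lte_add_pinfty//.
    under eq_integral do rewrite ger0_norm// EFinM.
    rewrite ge0_integralZl_EFin// ?lte_mul_pinfty//.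
    - by move=> z _; rewrite lee_fin.
    - exact/measurable_EFinP.
  under eq_integral do rewrite EFinM.
  rewrite ge0_integralZl_EFin// ?lte_mul_pinfty//.
  - by move=> z _; rewrite lee_fin sqr_ge0.
  - by apply/measurable_EFinP; exact: measurable_funX.
apply/q0/eqP; rewrite eq_le integral_ge0 ?andbT; last first.
  by move=> z _; rewrite lee_fin sqr_ge0.
rewrite -(leeD2rE _ _ wloo) -[in leLHS]wlE defect_cost wrE.
move/q0 : E' => <-; rewrite defect_cost leeD2r// lee_wpmul2l//.
Qed.

End affine_transport.

(** * Contraction towards a point under MCP *)

Section metric_continuity.
Context {R : realType}.
Implicit Types S T X : metricType R.

Lemma near_mdist_lt X (x : X) (e : R) :
  0 < e -> \forall y \near x, mdist x y < e.
Proof. by move=> e0; apply/metricType_numDomainType.nbhs_mdistP; exists e. Qed.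

Lemma open_mdist_ball X (x : X) (e : R) : open [set y | mdist x y < e].
Proof.
rewrite openE => y /= xy; apply/metricType_numDomainType.nbhs_mdistP.
exists (e - mdist x y); first by rewrite /= subr_gt0.
by move=> z /=; rewrite ltrBrDl; exact/le_lt_trans/metric_triangle.
Qed.

Lemma nonexpansive_continuous S T (f : S -> T) :
  (forall x y, mdist (f x) (f y) <= mdist x y) -> continuous f.
Proof.
move=> fd x; apply/metricType_numDomainType.cvgrPdist_lt => e e0; near=> y.
by rewrite (le_lt_trans (fd _ _))//; near: y; exact: near_mdist_lt.
Unshelve. all: by end_near. Qed.

Lemma mdist_lipschitz X (x y x' y' : X) :
  `|mdist x y - mdist x' y'| <= mdist x x' + mdist y y'.
Proof.
rewrite ler_norml; apply/andP; split.
  have := metric_triangle x' x y'; have := metric_triangle x y y'.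
  by rewrite (metric_sym x' x); lra.
have := metric_triangle x x' y; have := metric_triangle x' y' y.
by rewrite (metric_sym y' y); lra.
Qed.

Lemma continuous_mdist2 X : continuous (fun z : X * X => mdist z.1 z.2).
Proof.
move=> [x y]; apply/cvgrPdist_lt => e e0; have e2 : 0 < e / 2 by rewrite divr_gt0.
have [cx cy] : (fst @ nbhs (x, y) --> x) /\ (snd @ nbhs (x, y) --> y).
  by split; [exact: cvg_fst|exact: cvg_snd].
near=> z.
rewrite (le_lt_trans (mdist_lipschitz _ _ _ _))// (splitr e) ltrD//=; near: z.
  exact: (metricType_numDomainType.cvgr_dist_lt cx).
exact: (metricType_numDomainType.cvgr_dist_lt cy).
Unshelve. all: by end_near. Qed.

Lemma continuous_mdist X (x : X) : continuous (mdist x).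
Proof.
move=> y; apply/cvgrPdist_lt => e e0; near=> z.
rewrite (le_lt_trans (mdist_lipschitz _ _ _ _))// mdistxx add0r.
by near: z; exact: near_mdist_lt.
Unshelve. all: by end_near. Qed.

Lemma open_neq_point X (o : X) : open [set x | x != o].
Proof.
have -> : [set x | x != o] = (mdist o) @^-1` [set r | r != 0].
  by apply/seteqP; split => x /=; rewrite -mdist_gt0 lt0r mdist_ge0 andbT metric_sym.
by apply: open_comp => [x _|]; [exact: continuous_mdist|exact: open_neq].
Qed.

Lemma continuous_geo_eval X (t : {i01 R}) : continuous (@geo_eval R X t).
Proof. by apply: nonexpansive_continuous => g h; exact: mdist_geo_dist. Qed.

Lemma continuous_pair (U V W : topologicalType) (f : U -> V) (g : U -> W) :
  continuous f -> continuous g -> continuous (fun x => (f x, g x)).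
Proof. by move=> cf cg x; apply: cvg_pair; [exact: cf|exact: cg]. Qed.

End metric_continuity.

Lemma continuous_fst (S T : topologicalType) : continuous (@fst S T).
Proof. by move=> [x y]; exact: cvg_fst. Qed.

Lemma continuous_snd (S T : topologicalType) : continuous (@snd S T).
Proof. by move=> [x y]; exact: cvg_snd. Qed.

Section integral_bounds.
Context d (T : measurableType d) (R : realType).
Variable P : probability T R.
Local Open Scope ereal_scope.
Import HBNNSimple.

(* No measurability is needed: the integral of a nonnegative function is a
   supremum over the simple functions below it. *)
Lemma ge0_le_integral_lower (f g : T -> \bar R) (D E : set T) :
  D `<=` E -> (forall x, 0 <= f x) -> (forall x, 0 <= g x) ->
  (forall x, D x -> f x <= g x) ->
  \int[P]_(x in D) f x <= \int[P]_(x in E) g x.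
Proof.
move=> DE f0 g0 fg; rewrite !ge0_integralE//; apply: ereal_sup_le.
apply: image_subset => h /= hf x; apply: (le_trans (hf x)).
rewrite /patch; case: ifPn => [/set_mem Dx|_].
  by rewrite mem_set//; [exact: fg|exact: DE].
by case: ifPn.
Qed.

Lemma ae_bounded_integral (f : T -> \bar R) (c : R) :
  measurable_fun [set: T] f -> (forall x, 0 <= f x) -> (0 <= c)%R ->
  {ae P, forall x, f x <= c%:E} -> \int[P]_x f x <= c%:E.
Proof.
move=> mf f0 c0 fc.
have -> : c%:E = \int[P]_x (cst c%:E x).
  transitivity (c%:E * P setT); first by rewrite probability_setT mule1.
  by rewrite integral_cst.
apply: ae_ge0_le_integral => //.
by case: fc => A [mA PA sA]; exists A; split => // x /= h; apply: sA => /= fx; apply: h.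
Qed.

End integral_bounds.


Section geo_endpoints.
Context {R : realType} (X : completeMetricType R).

Definition geo_source : borel (geo X) -> borel X := geo_eval 0%:i01.

Definition geo_target : borel (geo X) -> borel X := geo_eval 1%:i01.

Definition geo_at (t : {i01 R}) : borel (geo X) -> borel X := geo_eval t.

Lemma measurable_geo_at t (B : set (borel X)) :
  measurable B -> measurable (geo_at t @^-1` B).
Proof.
by apply: generated_measurable_preimage; exact/continuousP/continuous_geo_eval.
Qed.

Lemma mdist_source_at (g : geo X) (t : {i01 R}) :
  mdist (geo_source g : X) (geo_at t g) =
  t%:num * mdist (geo_source g : X) (geo_target g).
Proof. by rewrite geo_const_speed/= sub0r normrN ger0_norm. Qed.

Lemma mdist_at_target (g : geo X) (t : {i01 R}) :
  mdist (geo_at t g : X) (geo_target g) =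
  (1 - t%:num) * mdist (geo_source g : X) (geo_target g).
Proof. by rewrite geo_const_speed/= distrC ger0_norm// subr_ge0. Qed.

End geo_endpoints.

Lemma P2_ae_bounded {R : realType} {X : completeMetricType R}
    (mu : probability (borel X) R) (o : X) (C : R) :
  0 <= C -> mu.-negligible [set x : borel X | C < mdist o (x : X)] -> P2 mu.
Proof.
move=> C0 muC; exists o; apply: (@le_lt_trans _ _ (C ^+ 2)%:E); last exact: ltry.
apply: ae_bounded_integral.
- apply/measurable_EFinP; apply: measurable_funX.
  by apply: generated_measurable_real; exact/continuousP/continuous_mdist.
- by move=> x; rewrite lee_fin sqr_ge0.
- by rewrite sqr_ge0.
apply: negligibleS muC => x /= /negP; rewrite lee_fin.
by rewrite ler_sqr ?nnegrE ?mdist_ge0// -ltNge.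
Qed.

Section mcp_plan.
Context {R : realType} {X : completeMetricType R}.
Variables (K N : R) (m : {measure set (borel X) -> \bar R}).
Hypotheses (N1 : 1 < N) (hMCP : MCP K N m).
Variable D : R.
Hypotheses (D0 : 0 < D) (KD : 0 < K -> D * Num.sqrt (K / (N - 1)) <= 1).
Local Open Scope ereal_scope.

(** The third clause is absolute continuity of the contraction of [m] restricted to [A] at every
    time before 1. It fails at time 1, where all mass sits at [o] and the coefficient bound
    degenerates. *)
Lemma MCP_plan (o : X) (A : set (borel X)) (mA : measurable A)
    (mu0 : probability (borel X) R) :
  0 < m A < +oo -> (forall a, A a -> (mdist o (a : X) <= D)%R) ->
  (forall B, mu0 B = ((fine (m A))^-1)%R%:E * mrestr m mA B) ->
  exists p : probability (borel (geo X)) R,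
    [/\ forall B : set (borel X), measurable B ->
          p (@geo_source R X @^-1` B) = mu0 B,
        p [set g | geo_target g != o] = 0 &
        forall t : {i01 R}, (t%:num < 1)%R ->
          forall B : set (borel X), measurable B -> m B = 0 ->
          p (geo_at t @^-1` B) = 0].
Proof.
move=> mA0 AD mu0E.
have mu0A : mu0 (~` A) = 0.
  by rewrite mu0E /mrestr setICl measure0 mule0.
have P2mu0 : P2 mu0.
  apply: (P2_ae_bounded (ltW D0) (o := o)); exists (~` A); split => //.
    exact: measurableC.
  by move=> x /=; rewrite ltNge => /negP; apply: contra_not => /AD.
have Aball : (0 < K)%R ->
    A `<=` (ball o (pi * Num.sqrt ((N - 1) / K)) : set X).
  move=> K0 x /AD xD; rewrite ballEmdist /=; apply: (le_lt_trans xD).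
  have s0 : (0 < Num.sqrt (K / (N - 1)))%R by rewrite sqrtr_gt0 divr_gt0// subr_gt0.
  rewrite -[((N - 1) / K)%R]invf_div sqrtrV ?divr_ge0 ?subr_ge0 ?ltW// ltr_pdivlMr//.
  by rewrite (le_lt_trans (KD K0))// (lt_le_trans _ (pi_ge2 R))// ltr1n.
have [p [s [[s1 s2] _] ps] pm] :=
  @hMCP o A mA mA0 mu0 (fun B _ => mu0E B) P2mu0 Aball.
have p0 B : measurable (B : set (borel X)) ->
    p (@geo_source R X @^-1` B) = mu0 B.
  move=> mB; rewrite -s1// /pushforward -ps//.
  apply: generated_measurable_preimage mB; exact/continuousP/continuous_fst.
have p1 B : measurable (B : set (borel X)) ->
    p (@geo_target R X @^-1` B) = dirac (o : borel X) B.
  move=> mB; rewrite -s2// /pushforward -ps//.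
  apply: generated_measurable_preimage mB; exact/continuousP/continuous_snd.
have mo : measurable ([set x | x != o] : set (borel X)).
  by apply: open_borel; exact: open_neq_point.
have p1o : p [set g | geo_target g != o] = 0.
  by rewrite (p1 _ mo) diracE memNset//= eqxx.
exists p; split => // t t1 B mB mB0.
have t01 : (0 < 1 - t%:num <= 1)%R by rewrite subr_gt0 t1/= gerBl.
have [c c0 cle] := tau_coef_ge N1 t01 KD.
pose eB := geo_at t @^-1` B.
pose e0 := @geo_source R X @^-1` A.
pose e1 := @geo_target R X @^-1` [set x | x != o].
have meB : measurable eB by exact: measurable_geo_at.
have me0 : measurable e0 by exact: measurable_geo_at.
have me1 : measurable e1 by exact: measurable_geo_at.
(* Geodesics from [A] to [o] have length at most [D], so on them the coefficient is at least [c].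
   All other geodesics form a null set. *)
pose S := eB `&` (e0 `\` e1).
have mS : measurable S by apply: measurableI => //; exact: measurableD.
have pS : c%:E * p S <= 0.
  have := pm t B mB; rewrite mB0 mule0; apply: le_trans.
  rewrite -integral_cst//.
  apply: ge0_le_integral_lower.
  - by move=> g [].
  - by move=> g; rewrite lee_fin ltW.
  - by move=> g; exact: poweR_ge0.
  - move=> g [_ [gA /= /negP/negPn/eqP go]]; apply: cle.
    by rewrite /geo_length mdist_ge0/= metric_sym [X in mdist X _]go AD.
have pS0 : p S = 0.
  by apply/eqP; rewrite -measure_le0 -(pmule_rle0 _ (_ : 0 < c%:E)).
have pe0 : p (~` e0) = 0 by rewrite -mu0A -p0//; exact: measurableC.
apply: measure_negligible => //.
apply: (@negligibleS _ _ _ _ (S `|` (~` e0 `|` e1))).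
  move=> g gB; have [ga|] := pselect (e0 g); last by right; left.
  by have [ge|] := pselect (e1 g); [right; right|left; split].
do 2?apply: negligibleU; apply/negligibleP => //.
exact: measurableC.
Qed.

End mcp_plan.

(** * Injectivity of the distance on one side *)

Section negligible.
Context d (T : measurableType d) (R : realType).
Local Open Scope ereal_scope.

Lemma eq_measure_off_negligible (P : {measure set T -> \bar R}) (A B E : set T) :
  measurable A -> measurable B -> P.-negligible E ->
  (forall x, ~ E x -> (A x <-> B x)) -> P A = P B.
Proof.
move=> mA mB [F [mF PF EF]] AB.
have h C : measurable C -> P C = P (C `\` F).
  move=> mC; rewrite (measureDI P mC mF) [X in _ + X](_ : _ = 0) ?adde0//.
  by apply: (subset_measure0 _ mF _ PF) => //; exact: measurableI.
rewrite h// (h B)//; congr (P _); apply/seteqP; split => x [Cx Fx]; split => //;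
  by apply/(AB x) => // Ex; apply/Fx/EF.
Qed.

Lemma mixture_negligible (P1 P2 Q : probability T R) (E : set T) :
  (forall A, Q A = (2^-1)%R%:E * P1 A + (2^-1)%R%:E * P2 A) ->
  P1.-negligible E -> P2.-negligible E -> Q.-negligible E.
Proof.
move=> QE [A1 [mA1 P1A EA1]] [A2 [mA2 P2A EA2]].
exists (A1 `&` A2); split; [exact: measurableI| |by move=> x Ex; split; [exact: EA1|exact: EA2]].
rewrite QE (@subset_measure0 _ _ _ P1 _ A1)//; last exact: measurableI.
by rewrite (@subset_measure0 _ _ _ P2 _ A2)// ?mule0 ?adde0//; exact: measurableI.
Qed.

End negligible.

Section no_branching.
Context {R : realType} {X : completeMetricType R}.
Variables (K N : R) (m : {measure set (borel X) -> \bar R}).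
Hypotheses (N1 : 1 < N) (hMCP : MCP K N m).
Hypothesis h1 : forall mu0 mu1 : probability (borel X) R,
     P2ac m mu0 -> P2ac m mu1 ->
     exists2 p, OptGeo mu0 mu1 p & induced_by_map mu0 p.
Variable D : R.
Hypotheses (D0 : 0 < D) (KD : 0 < K -> D * Num.sqrt (K / (N - 1)) <= 1).

Variables (x0 : X) (A : set X) (psi : R -> X) (l : R) (y z : X).
Hypotheses (oA : open A) (mA0 : (0 < m A < +oo)%E).
Hypotheses (cpsi : continuous psi) (psiK : forall a, A a -> psi (mdist x0 a) = a).
Hypotheses (yD : forall a, A a -> mdist y a <= D).
Hypotheses (zD : forall a, A a -> mdist z a <= D).
Hypotheses (x0y : mdist x0 y = l) (x0z : mdist x0 z = l).
(** A point [w] on the way from some [a'] to [y] or [z] is reached radially from every other [a] as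
    well. This makes the cost a function of distances to [x0] even for pairs joined by no chosen
    geodesic. *)
Hypothesis radial : forall a a' w q, A a -> A a' -> q = y \/ q = z ->
  mdist a' w + mdist w q = mdist a' q -> mdist x0 a <= mdist x0 w ->
  mdist a w = mdist x0 w - mdist x0 a.
(* Margin keeping the images at late times farther from x0 than A is. *)
Variable e1 : R.
Hypotheses (e10 : 0 < e1) (Ae1 : forall a, A a -> mdist x0 a <= l - e1).

Let h : X -> R := mdist x0.

Let mA : measurable (A : set (borel X)). Proof. exact: open_borel. Qed.

Let good q : set (borel (geo X)) := [set g | A (geo_source g) /\ geo_target g = q].

Let l0 : 0 <= l. Proof. by rewrite -x0y mdist_ge0. Qed.

(** The hypothesis [radial] is used twice, for the endpoint of [g] and for its point at time [t].
    The condition on [t] puts the latter at distance at least [l - e1] from [x0], hence no closer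
    than any point of [A]. *)
Let good_at q (g : geo X) (t : {i01 R}) : (1 - t%:num) * l <= e1 ->
  q = y \/ q = z -> good q g ->
  [/\ forall a, A a -> mdist a (geo_at t g : X) = h (geo_at t g) - h a,
      h (geo_at t g) = (1 - t%:num) * h (geo_source g) + t%:num * l,
      mdist q (geo_at t g) <= (1 - t%:num) * l,
      h (geo_at t g) <= l & h (geo_source g) <= l].
Proof.
move=> te qyz [Ag gq].
have hq : h q = l by rewrite /h; case: qyz => ->.
have gA : mdist (geo_source g : X) q = l - h (geo_source g).
  rewrite -hq; apply: (radial Ag Ag qyz); first by rewrite mdistxx addr0.
  by rewrite -/h hq (le_trans (Ae1 Ag))// gerBl ltW.
have s1 := mdist_source_at g t; have s2 := mdist_at_target g t.
rewrite gq in s1 s2.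
have r a : A a -> mdist a (geo_at t g : X) = h (geo_at t g) - h a.
  move=> Aa; apply: (radial Aa Ag qyz); first by rewrite s1 s2; ring.
  apply: (le_trans (Ae1 Aa)); rewrite lerBlDr -[l in leLHS]hq.
  apply: (le_trans (metric_triangle _ (geo_at t g : X) _)); rewrite lerD2l s2 gA.
  by apply: le_trans te; rewrite ler_wpM2l ?subr_ge0// gerBl mdist_ge0.
have hg : h (geo_at t g) = (1 - t%:num) * h (geo_source g) + t%:num * l.
  by have := r _ Ag; rewrite s1 gA; lra.
have hl : h (geo_source g) <= l by rewrite -subr_ge0 -gA mdist_ge0.
split => //.
  rewrite metric_sym s2 gA ler_wpM2l ?subr_ge0//.
  by rewrite gerBl mdist_ge0.
have t0 : 0 <= 1 - t%:num by rewrite subr_ge0.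
have : 0 <= (1 - t%:num) * (l - h (geo_source g)) by rewrite mulr_ge0// subr_ge0.
by rewrite hg; lra.
Qed.

Lemma no_branching : y = z.
Proof.
apply: contrapT => /eqP yz.
(* Half the distance makes the balls of radius [e] about [y] and [z] disjoint; the bound [e1] makes
   [good_at] applicable. *)
pose e := Num.min (mdist y z / 2) e1.
have e0 : 0 < e by rewrite lt_min divr_gt0//= ?mdist_gt0.
have eyz : e <= mdist y z / 2 by rewrite ge_min lexx.
have ee1 : e <= e1 by rewrite ge_min lexx orbT.
have le0 : 0 < l + e by rewrite ltr_wpDl.
(* Chosen so that [k * l < e]: at time [1 - k], the two images lie within [e] of [y] and of [z]. The
   affine map of distances is then [k * h + b]. *)
pose k := e / (l + e).
have k0 : 0 < k by rewrite divr_gt0.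
have k1 : k <= 1 by rewrite ler_pdivrMr// mul1r lerDr.
have kl : k * l < e.
  by rewrite /k mulrAC ltr_pdivrMr// ltr_pM2l// ltrDl.
pose b := (1 - k) * l.
have b0 : 0 <= b by rewrite mulr_ge0// subr_ge0.
have k10 : 0 <= 1 - k by rewrite subr_ge0.
have k11 : 1 - k <= 1 by rewrite gerBl ltW.
pose t : {i01 R} := Itv01 k10 k11.
have tE : t%:num = 1 - k by [].
have t1 : t%:num < 1 by rewrite tE gtrBl.
have kE : 1 - t%:num = k by rewrite tE subKr.
have te : (1 - t%:num) * l <= e1 by rewrite kE (le_trans (ltW kl)).
have [mu0 mu0E] := normalized_restriction mA mA0.
have [py [py0 py1 pym]] := MCP_plan N1 hMCP D0 KD mA0 yD mu0E.
have [pz [pz0 pz1 pzm]] := MCP_plan N1 hMCP D0 KD mA0 zD mu0E.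
have [p pE] := half_mixture py pz.
clearbody t.
have bad q (P : probability (borel (geo X)) R) :
    (forall B : set (borel X), measurable B -> P (@geo_source R X @^-1` B) = mu0 B) ->
    P [set g | geo_target g != q] = 0%E -> P.-negligible (~` good q).
  move=> P0 P1; have : P (@geo_source R X @^-1` ~` A) = 0%E.
    rewrite P0; last exact: measurableC.
    by rewrite mu0E /mrestr setICl measure0 mule0.
  move=> PA; apply: (@negligibleS _ _ _ P
      ((@geo_source R X @^-1` ~` A) `|` [set g | geo_target g != q])).
    move=> g /= /not_andP[gA|/eqP gq]; by [left|right].
  apply: negligibleU; apply/negligibleP => //.
    by apply: measurable_geo_at; exact: measurableC.
  apply: (@measurable_geo_at _ _ _ [set x | x != q]).
  by apply: open_borel; exact: open_neq_point.
have bady := bad y py py0 py1.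
have badz := bad z pz pz0 pz1.
have badp : p.-negligible (~` (good y `|` good z)).
  rewrite setCU; apply: (mixture_negligible pE).
    by apply: negligibleS bady => g [].
  by apply: negligibleS badz => g [].
have mgt : measurable_fun [set: borel (geo X)] (@geo_at R X t).
  by apply: generated_measurable_fun; exact/continuousP/continuous_geo_eval.
have mgs : measurable_fun [set: borel (geo X)]
    ((fun g => (geo_source g : X, geo_at t g : X)) : borel (geo X) -> borel (X * X)%type).
  apply: generated_measurable_fun; apply/continuousP/continuous_pair;
    exact: continuous_geo_eval.
(* The target measure [mu1] is the average of the two images. The joint law [s'] of source and time
   [t] point is the explicit coupling with which the optimal plan is compared. *)
have [mu1 mu1E] := pushforward_probability p mgt.
have [s' s'E] := pushforward_probability p mgs.
have P2mu0 : P2ac m mu0.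
  split.
    apply: (P2_ae_bounded (ltW D0) (o := y)).
    exists (~` A); split; first exact: measurableC.
      by rewrite mu0E /mrestr setICl measure0 mule0.
    by move=> x /=; rewrite ltNge => /negP; apply: contra_not => /yD.
  apply/null_content_dominatesP => B mB mB0; rewrite mu0E /mrestr.
  rewrite [m (B `&` A)](_ : _ = 0%E) ?mule0//.
  by apply: (subset_measure0 _ mB _ mB0) => //; exact: measurableI.
have P2mu1 : P2ac m mu1.
  split.
    apply: (@P2_ae_bounded _ _ _ x0 l) => //.
    have mC : measurable ([set x | l < mdist x0 x] : set (borel X)).
      apply: open_borel.
      by apply: (@open_comp _ _ (mdist x0) [set r | l < r]) => [x _|];
        [exact: continuous_mdist|exact: open_gt].
    exists [set x : borel X | l < mdist x0 (x : X)]; split => //; rewrite mu1E.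
    apply: measure_negligible; first by exact: measurable_geo_at.
    apply: negligibleS badp => g /= gl gyz; move: gl; apply/negP; rewrite -leNgt.
    have [q qyz gq] : exists2 q, q = y \/ q = z & good q g.
      by case: gyz => ?; [exists y => //; left|exists z => //; right].
    by have [] := good_at te qyz gq.
  apply/null_content_dominatesP => B mB mB0; rewrite mu1E pE.
  by rewrite pym// pzm// !mule0 adde0.
have [p1 [s [sC sopt] ps] [T [mT Tp T0]]] := h1 P2mu0 P2mu1.
pose S : borel X -> borel X := fun a => geo_target (T a).
have mSB B : measurable B -> measurable (S @^-1` B).
  move=> mB; rewrite -[X in measurable X]setTI.
  exact: (mT measurableT _ (measurable_geo_at _ mB)).
have mends (B : set (borel (X * X)%type)) : measurable B ->
    measurable ((@geo_ends R X : borel (geo X) -> borel (X * X)%type) @^-1` B).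
  apply: generated_measurable_preimage; apply/continuousP/continuous_pair;
    exact: continuous_geo_eval.
have mfst (B : set (borel X)) : measurable B ->
    measurable ((fst : borel (X * X)%type -> borel X) @^-1` B).
  by apply: generated_measurable_preimage; exact/continuousP/continuous_fst.
have msnd (B : set (borel X)) : measurable B ->
    measurable ((snd : borel (X * X)%type -> borel X) @^-1` B).
  by apply: generated_measurable_preimage; exact/continuousP/continuous_snd.
have Tends a : geo_ends (T a) = (a : X, S a : X).
  by apply/pair_equal_spec; split; [exact: T0|].
have sE B : measurable B -> s B = mu0 [set a | B (a, S a)].
  move=> mB; rewrite -ps// /pushforward -Tp; last exact: mends.
  by congr (mu0 _); apply/seteqP; split => a; rewrite /preimage/mkset Tends.
have mu0S B : measurable B -> mu0 (S @^-1` B) = mu1 B.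
  by move=> mB; rewrite -sC.2// /pushforward (sE _ (msnd _ mB)).
have s'C : coupling mu0 mu1 s'.
  split=> B mB; rewrite /pushforward s'E; last by rewrite mu1E.
  transitivity (p (@geo_source R X @^-1` B)); first by [].
  rewrite pE py0// pz0// -[mu0 B]fineK ?fin_num_measure//.
  by rewrite -!EFinM -EFinD; congr EFin; lra.
have goodE g : (good y `|` good z) g -> exists2 q, q = y \/ q = z & good q g.
  by case=> ?; [exists y => //; left|exists z => //; right].
(* The plan [s] is accessible only through its marginals: the first is carried by [A] and the second
   by [V], and this alone forces the distance to equal [v - u] almost surely. Closedness of [V]
   gives its measurability. *)
pose V : set X := [set w | forall a, A a -> mdist a w = h w - h a].
have mV : measurable (V : set (borel X)).
  apply: closed_borel.
  have -> : V = \bigcap_(a in A) [set w | mdist a w - (h w - h a) = 0].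
    apply/seteqP; split => w Vw a Aa /=; first by rewrite (Vw a Aa) subrr.
    by apply/eqP; rewrite -subr_eq0; apply/eqP; exact: Vw.
  apply: closed_bigI => a _.
  apply: (@closed_comp _ _ (fun w => mdist a w - (h w - h a)) [set r | r = 0]).
    move=> w _; apply: cvgB; first exact: continuous_mdist.
    by apply: cvgB; [exact: continuous_mdist|exact: cvg_cst].
  exact: closed_eq.
have s'0 (C : set (borel (X * X)%type)) : measurable C ->
    (forall g, (good y `|` good z) g -> ~ C (geo_source g : X, geo_at t g : X)) ->
    s' C = 0%E.
  move=> mC gC; rewrite s'E; apply: measure_negligible.
    by rewrite -[X in measurable X]setTI; exact: mgs.
  by apply: negligibleS badp => g Cg /gC.
have mh : measurable_fun [set: borel X] (h : borel X -> R).
  by apply: generated_measurable_real; exact/continuousP/continuous_mdist.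
have mS : measurable_fun [set: borel X] S.
  by move=> _ C mC; rewrite setTI; exact: mSB.
have mu1V : mu1 (~` V) = 0%E.
  rewrite mu1E; apply: measure_negligible.
    by apply: measurable_geo_at; exact: measurableC.
  apply: negligibleS badp => g /=; apply: contra_not => /goodE[q qyz gq].
  by have [] := good_at te qyz gq.
pose u (w : borel (X * X)%type) : R := h (w : X * X).1.
pose v (w : borel (X * X)%type) : R := h (w : X * X).2.
pose dz (w : borel (X * X)%type) : R := mdist (w : X * X).1 (w : X * X).2.
have mdz : measurable_fun setT dz.
  by apply: generated_measurable_real; exact/continuousP/continuous_mdist2.
have mu : measurable_fun setT u.
  apply: (measurableT_comp mh) => _ C mC; rewrite setTI; exact: mfst.
have mv : measurable_fun setT v.
  apply: (measurableT_comp mh) => _ C mC; rewrite setTI; exact: msnd.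
have mpair (B : set (borel (X * X)%type)) : measurable B ->
    measurable [set a : borel X | B (a, S a)].
  move=> mB; rewrite (_ : mkset _ = T @^-1` (@geo_ends R X @^-1` B)).
    by have := mT measurableT _ (mends _ mB); rewrite setTI.
  by apply/seteqP; split => a; rewrite /preimage/mkset Tends.
pose E1 : set (borel (X * X)%type) := [set w | dz w != v w - u w].
have mE1 : measurable E1 by apply: measurable_neqr => //; exact: measurable_funB.
have s'E1 : s' E1 = 0%E.
  apply: s'0 => // g /goodE[q qyz gq]; have [r _ _ _ _] := good_at te qyz gq.
  by apply/negP/negPn/eqP; exact: (r _ gq.1).
have mu0A : mu0 (~` A) = 0%E by rewrite mu0E /mrestr setICl measure0 mule0.
have sE1 : s E1 = 0%E.
  rewrite sE//; apply: measure_negligible; first exact: mpair.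
  apply: (@negligibleS _ _ _ mu0 (~` A `|` S @^-1` ~` V)).
    move=> a /=; apply: contraPP => /not_orP[/contrapT Aa /contrapT Va].
    by apply/negP/negPn/eqP; exact: (Va _ Aa).
  have mCV : measurable (~` V : set (borel X)) by exact: measurableC.
  apply: negligibleU; [exists (~` A)|exists (S @^-1` ~` V)]; split => //.
  - exact: measurableC.
  - exact: mSB.
  - exact: (etrans (mu0S _ mCV) mu1V).
have costE (Q : probability (borel (X * X)%type) R) : Q E1 = 0%E ->
    transport_cost Q = (\int[Q]_w ((v w - u w) ^+ 2)%:E)%E.
  move=> QE1; apply: ge0_ae_eq_integral => //.
  - by apply/measurable_EFinP; exact: measurable_funX.
  - by apply/measurable_EFinP; apply: measurable_funX; exact: measurable_funB.
  - by move=> w _; rewrite lee_fin sqr_ge0.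
  - by move=> w _; rewrite lee_fin sqr_ge0.
  exists E1; split => // w /=; apply: contra_notP => /negP/negPn/eqP wE _.
  by rewrite -wE.
(* One constant bounding both [l] and its square, hence [v] and the square of [u] on good
   geodesics. *)
pose l' := l + l ^+ 2.
have l2 : l <= l' by rewrite lerDl sqr_ge0.
have l3 : l ^+ 2 <= l' by rewrite lerDr.
have bnd (f : borel (X * X)%type -> R) : measurable_fun setT f ->
    (forall w, 0 <= f w) ->
    (forall g, (good y `|` good z) g -> f (geo_source g : X, geo_at t g : X) <= l') ->
    (\int[s']_w (f w)%:E < +oo)%E.
  move=> mf f0 fg; apply: (@le_lt_trans _ _ l'%:E); last exact: ltry.
  have mlf : measurable [set w | l' < f w].
    have := mf measurableT _ (measurable_itv `]l', +oo[); rewrite setTI.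
    by congr measurable; apply/seteqP; split => w /=; rewrite in_itv/= andbT.
  apply: ae_bounded_integral.
  - exact/measurable_EFinP.
  - by move=> w; rewrite lee_fin.
  - exact: le_trans l2.
  exists [set w | l' < f w]; split => //.
    by apply: s'0 => // g /fg; rewrite leNgt => /negP.
  by move=> w /= /negP; rewrite lee_fin -ltNge.
(* Under [s'] the affine relation holds by construction; optimality of [s] and rigidity transfer it
   to [s]. *)
have def0 : s [set w | v w != k * u w + b] = 0%E.
  have su B : measurable B -> s (u @^-1` B) = s' (u @^-1` B).
    move=> mB; have mhB : measurable (h @^-1` B : set (borel X)).
      by rewrite -[X in measurable X]setTI; exact: mh.
    by transitivity (mu0 (h @^-1` B)); [exact: sC.1|exact/esym/s'C.1].
  have sv B : measurable B -> s (v @^-1` B) = s' (v @^-1` B).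
    move=> mB; have mhB : measurable (h @^-1` B : set (borel X)).
      by rewrite -[X in measurable X]setTI; exact: mh.
    by transitivity (mu1 (h @^-1` B)); [exact: sC.2|exact/esym/s'C.2].
  apply: (affine_transport_rigidity (P := s) (P' := s') mu mv _ _ (ltW k0) k1 b0 su sv).
  - by move=> w; exact: mdist_ge0.
  - by move=> w; exact: mdist_ge0.
  - apply: bnd mv _ _ => [w|g /goodE[q qyz gq]]; first exact: mdist_ge0.
    by have [_ _ _ hl _] := good_at te qyz gq; exact: le_trans hl l2.
  - apply: bnd => [|w|g /goodE[q qyz gq]]; first exact: measurable_funX.
      exact: sqr_ge0.
    have [_ _ _ _ hl] := good_at te qyz gq.
    rewrite /u/= (le_trans _ l3)// ler_sqr ?nnegrE//; exact: mdist_ge0.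
  - by rewrite -!costE//; exact: sopt.
  - apply: s'0 => [|g /goodE[q qyz gq]].
      by apply: measurable_neqr => //; apply: measurable_funD => //; exact: measurable_funM.
    have [_ hg _ _ _] := good_at te qyz gq.
    apply/negP/negPn/eqP; rewrite /v/u/= hg kE tE //.
have mdef : measurable [set a : borel X | h (S a) != k * h a + b].
  apply: measurable_neqr; first exact: measurableT_comp.
  by apply: measurable_funD => //; exact: measurable_funM.
have mu0def : mu0 [set a | h (S a) != k * h a + b] = 0%E.
  rewrite -def0 sE//.
  by apply: measurable_neqr => //; apply: measurable_funD => //; exact: measurable_funM.
(* Psi recovers the source of almost every transported point from its target. *)
pose Psi (w : borel X) : borel X := psi ((h w - b) / k).
have mPsi B : measurable B -> measurable (Psi @^-1` B).
  apply: generated_measurable_preimage; apply/continuousP => w.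
  apply: continuous_comp; last exact: cpsi.
  apply: cvgM; last exact: cvg_cst.
  by apply: cvgB; [exact: continuous_mdist|exact: cvg_cst].
pose B := [set w : borel X | mdist y (w : X) < e].
have mB : measurable B by apply: open_borel; exact: open_mdist_ball.
pose E := S @^-1` B.
have mE : measurable E by exact: mSB.
(* Only the half of [p] contracting to [y] reaches [B]: a point within [k * l] of [z] and within [e]
   of [y] would give [mdist y z < 2 * e]. On that half, [Psi] returns the source. *)
have pB C : measurable C ->
    p (geo_at t @^-1` (B `&` Psi @^-1` C)) = ((2^-1)%:E * mu0 C)%E.
  move=> mC; have mBC : measurable (B `&` Psi @^-1` C).
    by apply: measurableI => //; exact: mPsi.
  have mtBC := measurable_geo_at t mBC.
  rewrite pE [X in (_ + _ * X)%E](_ : _ = 0%E) ?mule0 ?adde0.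
    congr (_ * _)%E; rewrite -py0//.
    apply: (eq_measure_off_negligible mtBC (measurable_geo_at _ mC) bady).
    move=> g /contrapT gy; have [_ hg yg _ _] := good_at te (or_introl erefl) gy.
    have srcE : Psi (geo_at t g) = geo_source g.
      rewrite /Psi hg kE tE addrK mulrAC divff ?gt_eqF// mul1r psiK//.
      exact: gy.1.
    split=> [[_]|Cg]; first by rewrite /preimage/= srcE.
    split; first by rewrite /B/= (le_lt_trans yg)// kE.
    by rewrite /preimage/= srcE.
  apply: measure_negligible => //; apply: negligibleS badz => g [gB _] gz.
  have [_ _ zg _ _] := good_at te (or_intror erefl) gz.
  have := metric_triangle y (geo_at t g : X) z.
  move: gB zg; rewrite /B/= kE (metric_sym z) => gB zg.
  by have := kl; lra.
have E12 : mu0 E = (2^-1)%:E.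
  rewrite mu0S// -[B]setIT -(preimage_setT Psi) mu1E pB//.
  by rewrite probability_setT mule1.
(* Apply [pB] with [C] equal to [E] itself: almost surely [Psi (S a) = a], so asking in addition
   that [Psi (S a)] lie in [E] does not shrink [E]. *)
have E14 : mu0 E = ((2^-1)%:E * mu0 E)%E.
  rewrite -[in RHS]pB// -mu1E -mu0S; last by apply: measurableI => //; exact: mPsi.
  apply: (@eq_measure_off_negligible _ _ _ mu0 _ _
    (~` A `|` [set a | h (S a) != k * h a + b])) => //.
  - by apply: mSB; apply: measurableI => //; exact: mPsi.
  - apply: negligibleU; last by apply/negligibleP.
    by exists (~` A); split => //; exact: measurableC.
  move=> a /not_orP[/contrapT Aa /negP/negPn/eqP hSa].
  have SaE : Psi (S a) = a.
    by rewrite /Psi hSa addrK mulrAC divff ?gt_eqF// mul1r psiK.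
  by split=> [Ea|[]//]; split => //; rewrite /preimage/= SaE.
move: E14; rewrite E12 -EFinM => -[]; lra.
Qed.
End no_branching.

(** * Regular points *)

Section level.
Context {R : realType} (X : metricType R).

(** A curve of length below [mdist x y + e] meets the level [s] by the intermediate value theorem,
    and its length dominates the two-step route through that point. No compactness is invoked, so an
    excess [e] remains. *)
Lemma length_space_level (phi : X -> R) (x y : X) (s e : R) :
  length_space X -> continuous phi -> phi x <= s <= phi y -> 0 < e ->
  exists2 z, phi z = s & mdist x z + mdist z y <= mdist x y + e.
Proof.
move=> hX cphi /andP[xs sy] e0.
have : (ereal_inf [set curve_length c | c in
    [set c : R -> X | [/\ {within `[0%R, 1%R], continuous c}, c 0%R = x & c 1%R = y]]]
    < (mdist x y + e)%:E)%E by rewrite -hX lte_fin ltrDl.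
move=> /ereal_inf_lt[_ [c [cc c0 c1] <-] cl].
have [t t01 ct] : exists2 t, t \in `[0%R, 1%R] & (phi \o c) t = s.
  apply: IVT; first exact: ler01.
    by apply: within_continuous_comp => // u _; exact: cphi.
  by rewrite /= c0 c1 ge_min xs/= le_max sy orbT.
exists (c t) => //.
move: t01; rewrite in_itv/= => /andP[t0 t1].
have dxy : mdist x y <= mdist x y + e by rewrite lerDl ltW.
(* The extreme times are treated apart because a partition must be strictly increasing. *)
move: t0; rewrite le_eqVlt => /predU1P[<-|t0]; first by rewrite c0 mdistxx add0r.
move: t1; rewrite le_eqVlt => /predU1P[->|t1]; first by rewrite c1 mdistxx addr0.
rewrite -lee_fin; apply: (le_trans _ (ltW cl)).
apply: ereal_sup_ubound; exists [:: t; 1].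
  by rewrite /itv_partition/= t0 t1.
by rewrite /curve_variation [size _]/= big_nat_recl// big_nat1 /= c0 c1.
Qed.

End level.

Section chart.
Context {R : realType} {X : metricType R}.
Hypothesis hX : length_space X.
Implicit Types (x w : X) (psi : R -> X).

Definition chart x r psi := [/\ 0 < r, psi 0 = x,
  forall u v, `|u| < r -> `|v| < r -> mdist (psi u) (psi v) = `|u - v| &
  forall w, mdist x w < r -> exists2 u, `|u| < r & psi u = w].

(* Some point of the positive half of the chart lies between x and w; by
   [rside_dist] the same then holds for every such point.  The negative side is
   the positive side of [psi \o -%R]. *)
Definition rside x r psi w := exists2 u, 0 < u < r & mdist x w = u + mdist (psi u) w.

Lemma chart_dist x r psi u : chart x r psi -> `|u| < r -> mdist x (psi u) = `|u|.
Proof. by case=> r0 <- iso _ ur; rewrite iso ?normr0// sub0r normrN. Qed.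

Lemma chart_opp x r psi : chart x r psi -> chart x r (psi \o -%R).
Proof.
case=> r0 p0 iso sur; split => //=.
- by rewrite oppr0.
- by move=> u v ur vr; rewrite iso ?normrN// opprK addrC distrC.
- by move=> w /sur[u ur <-]; exists (- u); rewrite ?normrN ?opprK.
Qed.

Lemma chart_sphere x r psi z : chart x r psi -> mdist x z < r ->
  z = psi (mdist x z) \/ z = psi (- mdist x z).
Proof.
move=> ch zr; have [_ _ _ sur] := ch; have [u ur uz] := sur _ zr.
rewrite -{2 4}uz (chart_dist ch)// -uz.
by case: (ger0P u) => _; [left|right; rewrite opprK].
Qed.

(** An almost shortest curve from [x] to [w] crosses the sphere of radius [u], which consists of
    [psi u] and [psi (- u)]. If both routes had positive excess, a curve with excess below half the
    smaller one could cross at neither. *)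
Lemma chart_split x r psi w : chart x r psi -> x != w ->
  rside x r psi w \/ rside x r (psi \o -%R) w.
Proof.
move=> ch; rewrite -mdist_gt0 => xw; have [r0 _ _ _] := ch.
pose u := Num.min (r / 2) (mdist x w).
have u0 : 0 < u by rewrite lt_min divr_gt0.
have ur : u < r by rewrite gt_min; apply/orP; left; lra.
have uw : u <= mdist x w by rewrite ge_min lexx orbT.
have nu : `|u| < r by rewrite gtr0_norm.
have nNu : `|- u| < r by rewrite normrN.
have dxu := chart_dist ch nu; have dxNu := chart_dist ch nNu.
rewrite normrN gtr0_norm// in dxu dxNu.
apply: contrapT => /not_orP[np nm].
have gp : 0 < u + mdist (psi u) w - mdist x w.
  have := metric_triangle x (psi u) w; rewrite dxu => tri.
  rewrite subr_gt0 lt_neqAle tri andbT.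
  by apply/eqP => e; apply: np; exists u => //; rewrite u0.
have gm : 0 < u + mdist (psi (- u)) w - mdist x w.
  have := metric_triangle x (psi (- u)) w; rewrite dxNu => tri.
  rewrite subr_gt0 lt_neqAle tri andbT.
  by apply/eqP => e; apply: nm; exists u => //; rewrite u0.
set a := u + _ - _ in gp; set b := u + _ - _ in gm.
pose e := Num.min a b / 2.
have e0 : 0 < e by rewrite divr_gt0// lt_min gp.
have ep : e < a.
  by have : Num.min a b <= a by [rewrite ge_min lexx]; rewrite /e; lra.
have em : e < b.
  by have : Num.min a b <= b by [rewrite ge_min lexx orbT]; rewrite /e; lra.
have [|z zu ze] :=
    @length_space_level R X (mdist x) x w u e hX (@continuous_mdist _ _ x) _ e0.
  by rewrite mdistxx ltW.
have zr : mdist x z < r by rewrite zu.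
by case: (chart_sphere ch zr); rewrite zu => zE; move: ze;
  rewrite zu zE; move: ep em; rewrite /a /b; lra.
Qed.

Lemma rside_gt0 x r psi w : rside x r psi w -> 0 < mdist x w.
Proof. by case=> u /andP[u0 _] ->; rewrite ltr_wpDr// mdist_ge0. Qed.

(** For [v <= u], the route goes through [psi u] along the chart. For [v > u], an almost shortest
    route from [psi u] to [w] crosses the level [v] at [psi v] or at [psi (- v)]. *)
Lemma rside_dist x r psi w v : chart x r psi -> rside x r psi w ->
  0 <= v < r -> v <= mdist x w -> mdist (psi v) w = mdist x w - v.
Proof.
move=> ch [u /andP[u0 ur] xw] /andP[v0 vr] vw; have [r0 p0 iso sur] := ch.
have nu : `|u| < r by rewrite gtr0_norm.
have nv : `|v| < r by rewrite ger0_norm.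
have dxu := chart_dist ch nu; have dxv := chart_dist ch nv.
rewrite gtr0_norm// in dxu; rewrite ger0_norm// in dxv.
apply/eqP; rewrite eq_le; apply/andP; split; last first.
  by have := metric_triangle x (psi v) w; rewrite dxv; lra.
have [vu|uv] := leP v u.
  apply: (le_trans (metric_triangle _ (psi u) _)).
  by rewrite iso// distrC ger0_norm ?subr_ge0// xw; lra.
(* An excess of at most [u] excludes the crossing at [psi (- v)], which would pass back through the
   centre. *)
apply/ler_addgt0Pr => e e0; pose e' := Num.min e u.
have e'0 : 0 < e' by rewrite lt_min e0.
have [e'e e'u] : e' <= e /\ e' <= u by rewrite !ge_min !lexx orbT.
have [|z zv ze] :=
    @length_space_level R X (mdist x) (psi u) w v e' hX (@continuous_mdist _ _ x) _ e'0.
  by rewrite dxu ltW.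
have zr : mdist x z < r by rewrite zv.
have nNv : `|- v| < r by rewrite normrN.
have := metric_triangle x z w.
case: (chart_sphere ch zr); rewrite zv => zE; move: ze; rewrite zE.
  by rewrite iso// distrC gtr0_norm ?subr_gt0//; lra.
by rewrite iso// opprK gtr0_norm ?addr_gt0//; lra.
Qed.

(** Shortest routes from [x] to [a] and to [b] share an initial piece up to [psi u]; skipping it
    saves [2 * u]. *)
Lemma rside_dist_lt x r psi a b : chart x r psi -> rside x r psi a ->
  rside x r psi b -> mdist a b < mdist x a + mdist x b.
Proof.
move=> ch ra rb; have a0 := rside_gt0 ra; have b0 := rside_gt0 rb.
have [r0 _ _ _] := ch.
pose u := Num.min (r / 2) (Num.min (mdist x a) (mdist x b)).
have u0 : 0 < u by rewrite !lt_min divr_gt0//= a0.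
have ur : 0 <= u < r by rewrite ltW//= gt_min; apply/orP; left; lra.
have ua : u <= mdist x a by rewrite !ge_min lexx/= orbT.
have ub : u <= mdist x b by rewrite !ge_min lexx/= !orbT.
have := metric_triangle a (psi u) b.
rewrite (metric_sym a (psi u)) (rside_dist ch ra ur ua) (rside_dist ch rb ur ub).
by lra.
Qed.

End chart.

(** * Unique geodesics and propagation of regularity *)

Section unique_geodesics.
Context {R : realType} {X : metricType R}.
Hypothesis hX : length_space X.
Variable D : R.
Hypothesis D0 : 0 < D.
Hypothesis rside_inj : forall x r (psi : R -> X) y z, chart x r psi ->
  rside x r psi y -> rside x r psi z -> mdist x y = mdist x z -> mdist x y <= D ->
  y = z.
Implicit Types (x w : X) (psi : R -> X).

Definition regular x := exists r, exists psi, chart x r psi.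

(** Pigeonhole: of three points, two lie on the same side of [x], where the distance is
    injective. *)
Lemma regular_sphere x a b c : regular x -> 0 < mdist x a <= D ->
  mdist x b = mdist x a -> mdist x c = mdist x a -> [\/ a = b, b = c | a = c].
Proof.
move=> [r [psi ch]] /andP[a0 aD] ba ca.
have ch' := chart_opp ch.
have side w : mdist x w = mdist x a -> rside x r psi w \/ rside x r (psi \o -%R) w.
  by move=> wa; apply: chart_split ch _; rewrite // -mdist_gt0 wa.
have eqp u v : rside x r psi u -> rside x r psi v ->
    mdist x u = mdist x a -> mdist x v = mdist x a -> u = v.
  by move=> ru rv ua va; apply: (rside_inj ch) => //; rewrite ua.
have eqm u v : rside x r (psi \o -%R) u -> rside x r (psi \o -%R) v ->
    mdist x u = mdist x a -> mdist x v = mdist x a -> u = v.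
  by move=> ru rv ua va; apply: (rside_inj ch') => //; rewrite ua.
case: (side a erefl) => ra; case: (side b ba) => rb; case: (side c ca) => rc;
  by [apply: Or31; auto|apply: Or32; auto|apply: Or33; auto].
Qed.

(* The length structure only gives points of small excess at level s; since at
   most two points lie at that level, one of them has excess zero. *)
Lemma rside_geodesic x r psi w s : chart x r psi -> rside x r psi w ->
  mdist x w <= D -> 0 < s <= mdist x w ->
  exists z, [/\ rside x r psi z, mdist x z = s & mdist z w = mdist x w - s].
Proof.
move=> ch rw wD /andP[s0 sw]; have [r0 _ _ _] := ch.
pose u := Num.min (r / 2) s.
have u0 : 0 < u by rewrite lt_min divr_gt0.
have ur : u < r by rewrite gt_min; apply/orP; left; lra.
have us : u <= s by rewrite ge_min lexx orbT.
have ur' : 0 <= u < r by rewrite ltW.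
have uw := rside_dist hX ch rw ur' (le_trans us sw).
have dxu : mdist x (psi u) = u by rewrite (chart_dist ch) gtr0_norm.
pose exc z := mdist (psi u) z + mdist z w - mdist (psi u) w.
suff [z zs ze] : exists2 z, mdist x z = s & exc z <= 0.
  have := metric_triangle x (psi u) z; have := metric_triangle x z w.
  rewrite dxu zs => t1 t2; move: ze; rewrite /exc => ze.
  exists z; split => //; last by lra.
  by exists u; rewrite ?u0//; lra.
apply: contrapT => noz.
have pos z : mdist x z = s -> 0 < exc z.
  by move=> zs; rewrite ltNge; apply/negP => ze; apply: noz; exists z.
have approx e : 0 < e -> exists2 z, mdist x z = s & exc z <= e.
  move=> e0; have :=
    @length_space_level R X (mdist x) (psi u) w s e hX (@continuous_mdist _ _ x) _ e0.
  rewrite dxu us sw => /(_ isT)[z zs ze]; exists z => //.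
  by rewrite /exc lerBlDl.
(* Each new excess is at most half the preceding one and all are positive, so the three points are
   distinct, against [regular_sphere]. *)
have [z1 z1s _] := approx 1 ltr01.
have e1 := pos _ z1s.
have [|z2 z2s e21] := approx (exc z1 / 2); first by rewrite divr_gt0.
have e2 := pos _ z2s.
have [|z3 z3s e32] := approx (exc z2 / 2); first by rewrite divr_gt0.
have e3 := pos _ z3s.
have reg : regular x by exists r, psi.
have z1D : 0 < mdist x z1 <= D by rewrite z1s s0 (le_trans sw).
case: (regular_sphere reg z1D (etrans z2s (esym z1s)) (etrans z3s (esym z1s))) => zz.
- by move: e21; rewrite -zz; lra.
- by move: e32; rewrite -zz; lra.
- by move: e32; rewrite -zz; lra.
Qed.

(** The geodesic to the farther point contains a point at the distance of the nearer one, and by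
    injectivity it is the nearer one. *)
Lemma rside_isometry x r psi w w' : chart x r psi -> rside x r psi w ->
  rside x r psi w' -> mdist x w <= D -> mdist x w' <= D ->
  mdist w w' = `|mdist x w - mdist x w'|.
Proof.
move=> ch; wlog ww' : w w' / mdist x w <= mdist x w'.
  move=> H rw rw' wD w'D; have [/H->//|/ltW/H h] := leP (mdist x w) (mdist x w').
  by rewrite metric_sym distrC; exact: h.
move=> rw rw' wD w'D.
have [|z [rz zs zw]] := rside_geodesic ch rw' w'D (s := mdist x w).
  by rewrite (rside_gt0 rw).
have <- : z = w by apply: (rside_inj ch) => //; rewrite zs.
by rewrite zw zs distrC ger0_norm ?subr_ge0.
Qed.

Definition isometric_on (zeta : R -> X) (l : R) :=
  forall s t, 0 <= s <= l -> 0 <= t <= l -> mdist (zeta s) (zeta t) = `|s - t|.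

Lemma rside_curve x r psi w : chart x r psi -> rside x r psi w ->
  mdist x w <= D -> exists zeta : R -> X,
    [/\ zeta 0 = x, zeta (mdist x w) = w, isometric_on zeta (mdist x w) &
      forall s, 0 < s <= mdist x w -> rside x r psi (zeta s) /\ mdist x (zeta s) = s].
Proof.
move=> ch rw wD.
have /choice[f fP] : forall s, exists z, 0 < s <= mdist x w ->
    rside x r psi z /\ mdist x z = s.
  move=> s; have [sw|nsw] := boolP (0 < s <= mdist x w); last by exists x.
  by have [z [rz zs _]] := rside_geodesic ch rw wD sw; exists z.
pose zeta s := if s <= 0 then x else f s.
have zP s : 0 < s <= mdist x w -> rside x r psi (zeta s) /\ mdist x (zeta s) = s.
  by move=> sw; rewrite /zeta leNgt; have /andP[-> _] := sw; exact: fP.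
have z0 : zeta 0 = x by rewrite /zeta lexx.
have w0 := rside_gt0 rw.
exists zeta; split => //.
  have [|rz zw] := zP (mdist x w); first by rewrite w0/=.
  by apply: (rside_inj ch) => //; rewrite zw.
have d0 t : 0 <= t <= mdist x w -> mdist x (zeta t) = t.
  move=> /andP[]; rewrite le_eqVlt => /predU1P[<- _|t0 tw]; first by rewrite z0 mdistxx.
  by apply: (zP _ _).2; rewrite t0.
move=> s t /andP[s0 sw] /andP[t0 tw]; move: s0; rewrite le_eqVlt => /predU1P[<-|s0].
  by rewrite z0 d0 ?t0// sub0r normrN ger0_norm.
move: t0; rewrite le_eqVlt => /predU1P[<-|t0].
  by rewrite z0 metric_sym d0 ?(ltW s0)// subr0 gtr0_norm.
have [|rs es] := zP s; first by rewrite s0.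
have [|rt et] := zP t; first by rewrite t0.
by rewrite (rside_isometry ch rs rt) ?es ?et// (le_trans _ wD).
Qed.

(** The sphere of radius [d] about [zeta s] already contains the distinct points [zeta (s + d)] and
    [zeta (s - d)], so by [regular_sphere] it contains no other. Hence a ball about [zeta s] is a
    piece of the geodesic, and re-centring it gives a chart at [zeta s']. *)
Lemma regular_on_geodesic zeta l s s' : isometric_on zeta l -> l <= D ->
  0 < s < l -> regular (zeta s) -> `|s' - s| < Num.min s (l - s) ->
  regular (zeta s').
Proof.
move=> iso lD /andP[s0 sl] reg; set m := Num.min s (l - s) => s'm.
have ms : m <= s by rewrite ge_min lexx.
have ml : m <= l - s by rewrite ge_min lexx orbT.
have iso' u v : `|u - s| < m -> `|v - s| < m -> mdist (zeta u) (zeta v) = `|u - v|.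
  by rewrite !ltr_distl => /andP[? ?] /andP[? ?]; apply: iso; lra.
have onz v : mdist (zeta s) v < m -> exists2 t, `|t - s| < m & zeta t = v.
  move=> vm; have [v0|v0] := eqVneq v (zeta s).
    by exists s => //; rewrite subrr normr0 (le_lt_trans _ vm)// mdist_ge0.
  pose d := mdist (zeta s) v; have d0 : 0 < d by rewrite mdist_gt0 eq_sym.
  have dm : d < m by [].
  have n1 : `|s + d - s| < m by rewrite addrC addKr gtr0_norm.
  have n2 : `|s - d - s| < m by rewrite addrC addKr normrN gtr0_norm.
  have n3 : `|s - s| < m by rewrite subrr normr0 (lt_trans d0).
  have e1 : mdist (zeta s) (zeta (s + d)) = d.
    by rewrite iso'// opprD addrA subrr add0r normrN gtr0_norm.
  have e2 : mdist (zeta s) (zeta (s - d)) = d.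
    by rewrite iso'// opprB addrCA subrr addr0 gtr0_norm.
  have e12 : mdist (zeta (s + d)) (zeta (s - d)) = 2 * d.
    by rewrite iso'// gtr0_norm; lra.
  have [] := @regular_sphere (zeta s) (zeta (s + d)) (zeta (s - d)) v reg.
  - by rewrite e1 d0; lra.
  - by rewrite e1 e2.
  - by rewrite e1.
  - by move=> e; move: e12; rewrite e mdistxx; lra.
  - by move=> <-; exists (s - d).
  - by move=> <-; exists (s + d).
exists (m - `|s' - s|), (fun u => zeta (s' + u)).
have dst u : `|u| < m - `|s' - s| -> `|s' + u - s| < m.
  move=> um; rewrite addrAC (le_lt_trans (ler_normD _ _))//.
  by move: um; lra.
split.
- by rewrite subr_gt0.
- by rewrite addr0.
- move=> u v um vm; rewrite iso' ?dst//; congr `|_|; lra.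
move=> v vm; have [|t tm tv] := onz v.
  apply: (le_lt_trans (metric_triangle _ (zeta s') _)).
  rewrite iso'//; last by rewrite subrr normr0 (le_lt_trans _ s'm).
  by rewrite distrC; lra.
exists (t - s'); last by rewrite addrC subrK.
by move: vm; rewrite -tv iso'// distrC.
Qed.

(** The radius in [regular_on_geodesic] is at least [m] at every parameter between [s0] and [s], so
    finitely many steps of length [m / 2] suffice. *)
Lemma regular_propagate zeta l s0 s : isometric_on zeta l -> l <= D ->
  0 < s0 -> s0 <= s < l -> regular (zeta s0) -> regular (zeta s).
Proof.
move=> iso lD s00 /andP[s0s sl] reg.
pose m := Num.min s0 (l - s).
have m0 : 0 < m by rewrite lt_min s00 subr_gt0.
have ms : m <= s0 by rewrite ge_min lexx.
have ml : m <= l - s by rewrite ge_min lexx orbT.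
suff H n : forall t, s0 <= t <= s -> t <= s0 + n%:R * (m / 2) -> regular (zeta t).
  apply: (H (Num.truncn ((s - s0) / (m / 2))).+1); first by rewrite s0s/=.
  rewrite -lerBlDl -ler_pdivrMr ?divr_gt0//.
  by rewrite ltW// truncnS_gt.
elim: n => [|n IH] t /andP[s0t ts] tn.
  suff -> : t = s0 by [].
  by apply/eqP; rewrite eq_le s0t; move: tn; rewrite mul0r addr0 => ->.
pose t' := Num.max s0 (t - m / 2).
have t's0 : s0 <= t' by rewrite le_max lexx.
have t'1 : t - m / 2 <= t' by rewrite le_max lexx orbT.
have t't : t' <= t by rewrite ge_max s0t/=; lra.
have reg' : regular (zeta t').
  apply: IH; first by rewrite t's0/= (le_trans t't).
  rewrite ge_max; apply/andP; split; first by rewrite lerDl mulr_ge0// divr_ge0// ltW.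
  by move: tn; rewrite -natr1; lra.
apply: (regular_on_geodesic iso lD _ reg'); first by lra.
rewrite ger0_norm ?subr_ge0// lt_min; lra.
Qed.

End unique_geodesics.

(** * Local structure at an arbitrary point *)

Section local_structure.
Context {R : realType} {X : metricType R}.
Hypothesis hX : length_space X.
Variable D : R.
Hypothesis D0 : 0 < D.
Hypothesis rside_inj : forall x r (psi : R -> X) y z, chart x r psi ->
  rside x r psi y -> rside x r psi z -> mdist x y = mdist x z -> mdist x y <= D ->
  y = z.
Implicit Types (x w : X) (psi : R -> X).

Lemma chart_regular x r psi u : chart x r psi -> `|u| < r -> regular (psi u).
Proof.
move=> ch ur; have [r0 p0 iso sur] := ch.
exists (r - `|u|), (fun v => psi (u + v)).
have dst v : `|v| < r - `|u| -> `|u + v| < r.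
  by move=> vr; rewrite (le_lt_trans (ler_normD _ _))//; lra.
split.
- by rewrite subr_gt0.
- by rewrite addr0.
- by move=> v w vr wr; rewrite iso ?dst//; congr `|_|; lra.
move=> w wr; have [|v vr vw] := sur w.
  apply: (le_lt_trans (metric_triangle _ (psi u) _)).
  by rewrite (chart_dist ch)//; lra.
exists (v - u); last by rewrite addrC subrK.
by move: wr; rewrite -vw iso// distrC.
Qed.

Lemma regular_side x w : regular x -> x != w ->
  exists r psi, chart x r psi /\ rside x r psi w.
Proof.
move=> [r [psi ch]] /(chart_split hX ch)[|] rw; exists r.
  by exists psi.
by exists (psi \o -%R); split => //; exact: chart_opp.
Qed.

Lemma regular_curve x r psi w : chart x r psi -> rside x r psi w ->
  mdist x w <= D -> exists zeta : R -> X,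
    [/\ zeta (mdist x w) = w, isometric_on zeta (mdist x w),
      forall s, 0 < s <= mdist x w -> rside x r psi (zeta s) /\ mdist x (zeta s) = s &
      forall s, 0 < s < mdist x w -> regular (zeta s)].
Proof.
move=> ch rw wD; have [zeta [z0 zw iso zP]] := rside_curve hX rside_inj ch rw wD.
exists zeta; split => // s /andP[s0 sw].
have [r0 _ _ sur] := ch.
pose s' := Num.min (r / 2) s.
have s'0 : 0 < s' by rewrite lt_min divr_gt0.
have s'r : s' < r by rewrite gt_min; apply/orP; left; lra.
have s's : s' <= s by rewrite ge_min lexx orbT.
apply: (regular_propagate hX rside_inj iso wD s'0); first by rewrite s's.
have [|u ur <-] := sur (zeta s'); last exact: chart_regular ch ur.
have [|_ ->//] := zP s'.
by rewrite s'0 (le_trans s's)// ltW.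
Qed.

(** Each step gains [D / 4]: take [z] at distance [D] from [x] with excess at most [D / 4] towards
    [y], and move to the midpoint of the geodesic to [z]. The midpoint is used because [z] itself
    need not be regular. *)
Lemma regular_near x (y : X) : regular x -> exists2 x', regular x' & mdist x' y <= D.
Proof.
move=> reg; pose n := (Num.truncn (mdist x y / (D / 4))).+1.
have : mdist x y <= D + n%:R * (D / 4).
  apply: (@le_trans _ _ (n%:R * (D / 4))); last by rewrite lerDr ltW.
  by rewrite -ler_pdivrMr ?divr_gt0// ltW// truncnS_gt.
move: (n) => {n} n; elim: n x reg => [|n IH] x reg; first by rewrite mul0r addr0; exists x.
rewrite -natr1 mulrDl mul1r => xyn.
have [xy|xy] := leP (mdist x y) D; first by exists x.
have [||z zD zy] :=
    @length_space_level R X (mdist x) x y D (D / 4) hX (@continuous_mdist _ _ x).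
- by rewrite mdistxx !ltW.
- by rewrite divr_gt0.
have xz : x != z by rewrite -mdist_gt0 zD.
have [r [psi [ch rz]]] := regular_side reg xz.
have [|zeta [zw iso _ zreg]] := regular_curve ch rz; first by rewrite zD.
rewrite zD in zw iso zreg.
have h2 : 0 < D / 2 < D by have := D0; lra.
apply: (IH _ (zreg _ h2)).
apply: (le_trans (metric_triangle _ z _)).
have -> : mdist (zeta (D / 2)) z = D / 2.
  by rewrite -{1}zw iso ?ltr0_norm; lra.
by move: zy xyn; rewrite zD; lra.
Qed.

Definition half_chart (y : X) d (g : R -> X) := [/\ 0 < d, g 0 = y,
  forall s t, 0 <= s < d -> 0 <= t < d -> mdist (g s) (g t) = `|s - t| &
  forall w, mdist y w < d -> exists2 t, 0 <= t < d & g t = w].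

(** Take a point [p] on a geodesic to [y], slightly before [y]. All points near [y] lie on the same
    side of [p] as [y]. If one is farther from [p] than [y] is, then [y] is interior to a geodesic
    from [p]; otherwise the geodesic ends at [y] and fills a ball about it. *)
Lemma regular_or_boundary x (y : X) : regular x -> regular y \/ exists d g, half_chart y d g.
Proof.
move=> /(regular_near y)[x0 reg x0D].
have [<-|x0y] := eqVneq x0 y; first by left.
have [r [psi [ch ry]]] := regular_side reg x0y.
have [zeta [zy iso _ zreg]] := regular_curve ch ry x0D.
move: zy iso zreg; set l := mdist x0 y => zy iso zreg.
have l0 : 0 < l by rewrite mdist_gt0.
have lD : l <= D by [].
(* Points within [d] of [y] are within [2 * d] of [p], so their mirror images across [p] still have
   parameters in the geodesic. *)
pose d := l / 4; have d0 : 0 < d by rewrite divr_gt0.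
have dl : l = 4 * d by rewrite /d; lra.
pose p := zeta (l - d).
have pz t : 0 <= t <= l -> mdist p (zeta t) = `|l - d - t|.
  by move=> tl; rewrite iso//; lra.
have py : mdist p y = d by rewrite -zy pz ?ltr0_norm; lra.
have pneqy : p != y by rewrite -mdist_gt0 py.
have regp : regular p by apply: zreg; lra.
have [r1 [psi1 [ch1 ry1]]] := regular_side regp pneqy.
have pw2 w : mdist y w < d -> 0 < mdist p w < 2 * d.
  have := metric_triangle p w y; have := metric_triangle p y w.
  by rewrite (metric_sym w y) py; lra.
have rside_ball w : mdist y w < d -> rside p r1 psi1 w.
  move=> yw; have /andP[pw0 pw2d] := pw2 _ yw.
  have pw : p != w by rewrite -mdist_gt0.
  have [//|lw] := chart_split hX ch1 pw.
  (* The mirror image of [w] lies opposite to [y], because the geodesic from [a] to [y] passes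
     through [p]. Were [w] on that side too, it would equal [a], which is farther than [d] from
     [y]. *)
  pose a := zeta (l - d - mdist p w).
  have pa : mdist p a = mdist p w by rewrite pz ?gtr0_norm; lra.
  have ay : mdist a y = d + mdist p w by rewrite -zy iso ?ltr0_norm; lra.
  have paneq : p != a by rewrite -mdist_gt0 pa.
  have [ra|la] := chart_split hX ch1 paneq.
    by have := rside_dist_lt hX ch1 ra ry1; rewrite pa py ay; lra.
  have aw : a = w.
    by apply: (rside_inj (chart_opp ch1) la lw) => //; rewrite pa; lra.
  by move: yw; rewrite -aw metric_sym ay; lra.
have [[w yw pwd]|nw] := pselect (exists2 w, mdist y w < d & d < mdist p w).
  left; have rw := rside_ball w yw; have /andP[pw0 pw2d] := pw2 _ yw.
  have [|zeta' [_ _ zP' zreg']] := regular_curve ch1 rw; first by lra.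
  have [|rd pd] := zP' d; first by lra.
  have -> : y = zeta' d by apply: (rside_inj ch1 ry1 rd); rewrite ?pd ?py//; lra.
  by apply: zreg'; rewrite d0.
right; exists d, (fun t => zeta (l - t)); split => //.
- by rewrite subr0.
- by move=> s t /andP[s0 sd] /andP[t0 td]; rewrite iso; [rewrite distrC; congr (`|_|)| |]; lra.
move=> w yw; have rw := rside_ball w yw; have /andP[pw0 pw2d] := pw2 _ yw.
have pwd : mdist p w <= d by rewrite leNgt; apply/negP => h; apply: nw; exists w.
exists (d - mdist p w); first by lra.
have pE : mdist p (zeta (l - (d - mdist p w))) = mdist p w.
  by rewrite pz ?ltr0_norm; lra.
apply: (rside_inj ch1 _ rw) => //; last by rewrite pE; lra.
apply: rside_ball; rewrite -zy iso ?ger0_norm; lra.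
Qed.

End local_structure.

(** * Charts *)

Section local_charts.
Context {R : realType} {X : metricType R}.

Lemma isometry_within_to_real (U : set X) (f : X -> R) :
  (forall x y, U x -> U y -> `|f x - f y| = mdist x y) -> {within U, continuous f}.
Proof.
move=> iso; apply/subspace_continuousP => x Ux; apply/cvgrPdist_lt => e e0.
rewrite near_withinE; near=> y => Uy; rewrite (iso _ _ Ux Uy).
near: y; exact: near_mdist_lt.
Unshelve. all: by end_near. Qed.

Lemma isometry_within_from_real (V : set R) (g : R -> X) :
  (forall s t, V s -> V t -> mdist (g s) (g t) = `|s - t|) -> {within V, continuous g}.
Proof.
move=> iso; apply/subspace_continuousP => x Vx.
apply/metricType_numDomainType.cvgrPdist_lt => e e0.
rewrite near_withinE; near=> y => Vy; rewrite (iso _ _ Vx Vy).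
near: y; exact: cvgr_dist_lt.
Unshelve. all: by end_near. Qed.

Lemma isometry_homeomorphic (U : set X) (V : set R) (g : R -> X) :
  (forall s t, V s -> V t -> mdist (g s) (g t) = `|s - t|) ->
  g @` V = U -> homeomorphic_subsets U V.
Proof.
move=> iso gVU.
have /choice[f fP] : forall w, exists s, U w -> V s /\ g s = w.
  move=> w; have [Uw|] := pselect (U w); last by exists 0.
  by move: (Uw); rewrite -gVU => -[s Vs gs]; exists s.
have inj s t : V s -> V t -> g s = g t -> s = t.
  move=> Vs Vt gst; apply/eqP; rewrite -subr_eq0 -normr_eq0 -iso// gst mdistxx//.
exists f, g; split.
- apply: isometry_within_to_real => x y Ux Uy.
  by rewrite -iso; [rewrite (fP x Ux).2 (fP y Uy).2|exact: (fP x Ux).1|exact: (fP y Uy).1].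
- exact: isometry_within_from_real.
- by move=> x Ux; exact: (fP x Ux).1.
- by move=> s Vs; rewrite -gVU; exists s.
split=> [x /set_mem Ux|s /set_mem Vs]; first exact: (fP x Ux).2.
have Ugs : U (g s) by rewrite -gVU; exists s.
by have [Vf gf] := fP _ Ugs; exact: inj.
Qed.

Lemma separable_second_countable : separable X -> @second_countable X.
Proof.
move=> [S cS dS]; pose f (n : nat) (z : X) := [set y | mdist z y < n.+1%:R^-1].
exists (\bigcup_n (f n @` S)); first apply: bigcup_countable => // n _.
  exact: card_le_trans (card_image_le _ _) cS.
split=> [_ [n _ [z _ <-]]|x V]; first exact: open_mdist_ball.
move=> /metricType_numDomainType.nbhs_mdistP[e /= e0 eV].
have [n] := @ltr_add_invr R 0 (e / 2) (divr_gt0 e0 (ltr0Sn _ 1)).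
rewrite add0r => ne.
have [|w [/= xw Sw]] := dS (f n x) _ (open_mdist_ball x _).
  by exists x; rewrite /f/= mdistxx invr_gt0.
exists (f n w); first split => /=.
- by exists n => //; exists w.
- by rewrite /f/= metric_sym.
move=> v /= wv; apply: eV => /=.
move: xw wv ne; rewrite /f/=; move: (n.+1%:R^-1) => c xw wv ne.
by have := metric_triangle x w v; lra.
Qed.

End local_charts.

(** * Injectivity on one side of a chart *)

Section rside_injective.
Context {R : realType} {X : completeMetricType R}.
Variables (K N : R) (m : {measure set (borel X) -> \bar R}).
Hypotheses (N1 : 1 < N) (hX : metric_measure_space m) (hMCP : MCP K N m).
Hypothesis h1 : forall mu0 mu1 : probability (borel X) R,
     P2ac m mu0 -> P2ac m mu1 ->
     exists2 p, OptGeo mu0 mu1 p & induced_by_map mu0 p.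
Variable D : R.
Hypotheses (D0 : 0 < D) (KD : 0 < K -> D * Num.sqrt (K / (N - 1)) <= 1).

Lemma small_ball_measure (c : X) (r : R) : 0 < r -> exists2 rho : R,
  0 < rho <= r & (0 < m [set y | (mdist c y < rho)%R] < +oo)%E.
Proof.
move=> r0; have [_ _ _ /(_ c)[U [oU Uc] mU] spt] := hX.
have /metricType_numDomainType.nbhs_mdistP[e /= e0 eU] : nbhs c U.
  exact: open_nbhs_nbhs.
pose rho := Num.min r e; have rho0 : 0 < rho by rewrite lt_min r0.
exists rho; first by rewrite rho0 ge_min lexx.
have oB := open_mdist_ball c rho.
apply/andP; split.
  have : measure_support m c by rewrite spt.
  by apply; split => //=; rewrite mdistxx.
apply: le_lt_trans mU; apply: le_measure; rewrite ?inE; [exact: open_borel|exact: open_borel|].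
by move=> y /= yrho; apply: eU; rewrite /= (lt_le_trans yrho)// ge_min lexx orbT.
Qed.

Lemma rside_injective (x : X) (r : R) (psi : R -> X) (y z : X) : chart x r psi ->
  rside x r psi y -> rside x r psi z -> mdist x y = mdist x z -> mdist x y <= D ->
  y = z.
Proof.
move=> ch ry rz xyz xyD; have [r0 p0 iso sur] := ch.
have hL : length_space X by case: hX.
(* Inside the chart both points are [psi] at their common distance; transport is needed only beyond
   radius [r]. *)
have [lr|lr] := ltP (mdist x y) r.
  have lr' : 0 <= mdist x y < r by rewrite mdist_ge0.
  have ey := rside_dist hL ch ry lr' (lexx _).
  have := rside_dist hL ch rz lr'; rewrite -xyz subrr in ey * => /(_ (lexx _)) ez.
  by rewrite -(mdist_positivity _ _ ey) -(mdist_positivity _ _ ez).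
have r4 : 0 < r / 4 by rewrite divr_gt0.
(* A ball of radius at most [r / 4] about [psi (r / 2)] stays in the positive half, at distance at
   most [3 * r / 4] from [x]. This leaves the margin [r / 4] before [y] and [z]. *)
have [rho /andP[rho0 rhor] mA] := small_ball_measure (psi (r / 2)) r4.
pose A := [set a | mdist (psi (r / 2)) a < rho].
have nr2 : `|r / 2| < r by rewrite gtr0_norm; lra.
have AP a : A a -> exists u, [/\ 0 < u, u <= 3 * r / 4, a = psi u & mdist x a = u].
  move=> Aa; have := metric_triangle x (psi (r / 2)) a.
  rewrite (chart_dist ch nr2) gtr0_norm; last by lra.
  move: Aa; rewrite /A/= => Aa xa.
  have [|u ur ua] := sur a; first by lra.
  move: Aa; rewrite -ua iso// ltr_distl => /andP[u1 u2].
  have u0 : 0 < u by lra.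
  by exists u; split => //; [lra|rewrite (chart_dist ch ur) gtr0_norm].
(* The map [psi] is controlled only on the open interval of the chart, while [no_branching] asks for
   a globally continuous inverse of the distance; truncation supplies it. *)
pose clip (v : R) := if v <= 0 then 0 else if v <= 3 * r / 4 then v else 3 * r / 4.
have clip_r v : `|clip v| < r.
  rewrite ltr_norml /clip; case: ifPn => [_|]; first by lra.
  by rewrite -ltNge => v0; case: ifPn; lra.
have clip_le v w : `|clip v - clip w| <= `|v - w|.
  rewrite /clip; wlog vw : v w / v <= w.
    move=> H; have [/H//|/ltW/H] := leP v w.
    by rewrite distrC (distrC v).
  rewrite [leRHS]distrC (@ger0_norm _ (w - v)) ?subr_ge0// ler_norml.
  by repeat case: ifPn; rewrite -?ltNge; lra.
have cclip : continuous (psi \o clip).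
  move=> v; apply/metricType_numDomainType.cvgrPdist_lt => e e0; near=> w.
  rewrite /= (iso _ _ (clip_r v) (clip_r w)); apply: le_lt_trans (clip_le _ _) _.
  near: w; exact: cvgr_dist_lt.
have clipK a : A a -> (psi \o clip) (mdist x a) = a.
  move=> /AP[u [u0 ur -> ->]] /=; congr psi; rewrite /clip leNgt u0/=.
  by rewrite ur.
have Adist q a : rside x r psi q -> mdist x q = mdist x y -> A a ->
    mdist a q = mdist x y - mdist x a.
  move=> rq qy /AP[u [u0 ur -> ->]]; rewrite (rside_dist hL ch rq) ?qy//; lra.
have AD q a : rside x r psi q -> mdist x q = mdist x y -> A a -> mdist q a <= D.
  move=> rq qy Aa; rewrite metric_sym (Adist _ _ rq qy Aa).
  by rewrite (le_trans _ xyD)// gerBl mdist_ge0.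
apply: (@no_branching _ _ _ _ m N1 hMCP h1 D D0 KD x A (psi \o clip) (mdist x y) y z
  (open_mdist_ball _ _) mA cclip clipK _ _ _ _ _ (r / 4)) => //.
- by move=> a; exact: AD.
- by move=> a; apply: AD.
- move=> a a' w q Aa Aa' qyz e xaw.
  have [rq xq] : rside x r psi q /\ mdist x q = mdist x y by case: qyz => ->.
  have [u' [u'0 u'r a'E xa']] := AP _ Aa'.
  have [u [u0 ur aE xa]] := AP _ Aa.
  have := Adist q a' rq xq Aa'; rewrite xa' => da'q.
  have t1 := metric_triangle x w q; have t2 := metric_triangle x a' w.
  (* The triangle inequality through [w] makes [a'], a point of the positive half, lie between [x]
     and [w]. *)
  have rw : rside x r psi w.
    by exists u'; [lra|rewrite -a'E; lra].
  by rewrite aE (rside_dist hL ch rw) -?aE ?xa//; lra.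
- by move=> a /AP[u [u0 ur _ ->]]; lra.
Unshelve. all: by end_near. Qed.

End rside_injective.

(** * From metric charts to manifold charts *)

Section conclusion.
Context {R : realType} {X : metricType R}.

Lemma open_interval_regular (x : X) (r : R) : 0 < r ->
  isometric_to_open_interval (ball x r) -> regular x.
Proof.
move=> r0 [I [f [oI _ fI iso]]]; rewrite ballEmdist in fI iso.
have xx : mdist x x < r by rewrite mdistxx.
have Ifx : I (f x) by rewrite -fI; exists x.
have /nbhs_ballP[e /= e0 eI] : nbhs (f x) I by exact: open_nbhs_nbhs.
pose rho := Num.min r e; have rho0 : 0 < rho by rewrite lt_min r0.
have rr : rho <= r by rewrite ge_min lexx.
have re : rho <= e by rewrite ge_min lexx orbT.
have /choice[psi psiP] : forall u, exists w, `|u| < rho -> mdist x w < r /\ f w = f x + u.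
  move=> u; have [ur|ur] := ltP `|u| rho; last by exists x.
  have : I (f x + u).
    by apply: eI; rewrite /ball/= opprD addNKr normrN (lt_le_trans ur).
  by rewrite -fI => -[w xw fw]; exists w.
have iso' v w : mdist x v < r -> mdist x w < r -> `|f v - f w| = mdist v w.
  by move=> xv xw; rewrite iso// inE.
have inj v w : mdist x v < r -> mdist x w < r -> f v = f w -> v = w.
  by move=> xv xw fvw; apply: (@mdist_positivity R); rewrite -iso'// fvw subrr normr0.
exists rho, psi; split => //.
- have [|h1 h2] := psiP 0; first by rewrite normr0.
  by apply: inj => //; rewrite h2 addr0.
- move=> u v /psiP[u1 u2] /psiP[v1 v2]; rewrite -iso'// u2 v2.
  by congr (`|_|); ring.
move=> w xw; have xw' := lt_le_trans xw rr.
have fr : `|f w - f x| < rho by rewrite iso'// metric_sym.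
exists (f w - f x) => //; have [h1 h2] := psiP _ fr.
by apply: inj => //; rewrite h2 addrC subrK.
Qed.

Definition locally_half_line (x : X) := exists (U : set X) (W : set R),
  [/\ open_nbhs x U, open W & homeomorphic_subsets U (W `&` [set t | 0 <= t])].

Lemma regular_half_line (x : X) : regular x -> locally_half_line x.
Proof.
move=> [r [psi [r0 p0 iso sur]]].
(* Shifted to the right of 0, the interval misses the boundary of the half-line. *)
exists [set w | mdist x w < r], `]0, 2 * r[%classic; split.
- by split; [exact: open_mdist_ball|rewrite /= mdistxx].
- exact: interval_open.
have br t : (`]0, 2 * r[ `&` [set t | 0 <= t]) t -> `|t - r| < r.
  by case; rewrite /= in_itv/= ltr_distl subrr => /andP[t0 tr] _; lra.
apply: (@isometry_homeomorphic _ _ _ _ (fun t => psi (t - r))).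
  by move=> s t /br sr /br tr; rewrite iso//; congr (`|_|); ring.
apply/seteqP; split => [_ [t /br tr <-]|w /= /sur[u ur uw]].
  by rewrite /= -p0 iso ?normr0// sub0r normrN.
exists (u + r); last by rewrite addrK.
by move: ur; rewrite ltr_norml /= in_itv/= => /andP[u1 u2]; split; lra.
Qed.

Lemma half_chart_half_line (x : X) d g : half_chart x d g -> locally_half_line x.
Proof.
move=> [d0 g0 iso sur].
(* Intersecting with the half-line leaves [0, d), with [x] sent to the boundary point 0. *)
exists [set w | mdist x w < d], `](- d), d[%classic; split.
- by split; [exact: open_mdist_ball|rewrite /= mdistxx].
- exact: interval_open.
have br t : (`](- d), d[ `&` [set t | 0 <= t]) t -> 0 <= t < d.
  by case; rewrite /= in_itv/= => /andP[_ ->] ->.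
apply: (@isometry_homeomorphic _ _ _ _ g).
  by move=> s t /br sr /br tr; rewrite iso.
apply/seteqP; split => [_ [t /br tr <-]|w /= /sur[t td gt]].
  rewrite /= -g0 iso ?lexx//; have /andP[t0 td] := tr.
  by rewrite sub0r normrN ger0_norm.
exists t => //; have /andP[t0 td'] := td; split => //.
by rewrite /= in_itv/= td' andbT (lt_le_trans _ t0)// oppr_lt0.
Qed.

End conclusion.

Theorem theorem3p5 (R : realType) (K N : R) (hN : 1 < N)
  (X : completeMetricType R) (m : {measure set (borel X) -> \bar R})
  (hX : metric_measure_space m)
  (hMCP : MCP K N m)
  (h1 : forall mu0 mu1 : probability (borel X) R,
     P2ac m mu0 -> P2ac m mu1 ->
     exists2 p, OptGeo mu0 mu1 p & induced_by_map mu0 p)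
  (h2 : exists x : X, exists2 r : R,
     0 < r & isometric_to_open_interval (ball x r)) :
  one_manifold_with_boundary R X.
Proof.
have [_ sepX lenX _ _] := hX.
split; [exact: metric_hausdorff|exact: separable_second_countable|].
(* At scale D the radius condition of MCP holds and the distortion coefficients
   stay away from their singularity, so no diameter bound is needed. *)
pose D := (1 + Num.sqrt (K / (N - 1)))^-1.
have s0 : 0 < 1 + Num.sqrt (K / (N - 1)) by rewrite ltr_wpDr// sqrtr_ge0.
have D0 : 0 < D by rewrite invr_gt0.
have KD : 0 < K -> D * Num.sqrt (K / (N - 1)) <= 1.
  by move=> _; rewrite /D mulrC ler_pdivrMr// mul1r lerDr ler01.
have inj := rside_injective hN hX hMCP h1 D0 KD.
have [x0 [r r0 /(open_interval_regular r0) reg]] := h2.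
move=> x; have [rx|[d [g gx]]] := regular_or_boundary lenX D0 inj x reg.
  exact: regular_half_line rx.
exact: half_chart_half_line gx.
Qed.
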